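(* For every $n\geq 0$ there exists a set $X$ which is low${}_2$ over $\emptyset^{(n)}$ (i.e. $(X\oplus\emptyset^{(n)})''\leq_T\emptyset^{(n+2)}$) and which bounds $\mathsf{RRT}^{n+2}_2$, i.e. every computable $2$-bounded coloring $f:[\omega]^{n+2}\to\omega$ has an $X$-computable infinite rainbow.
   Context: A coloring $f:[\omega]^m\to\omega$ is $k$-bounded if $|f^{-1}(y)|\leq k$ for every $y$; a set $R$ is a rainbow for $f$ if $f$ restricted to $[R]^m$ is injective. $\mathsf{RRT}^m_k$: every $k$-bounded $f:[\omega]^m\to\omega$ has an infinite rainbow. $\emptyset^{(n)}$ is the $n$-th jump of $\emptyset$. *)

(* Defs.v *)
From Stdlib Require Import Arith List Sorted.
Import ListNotations.

Definition pair (x y : nat) : nat := y + (x + y) * (x + y + 1) / 2.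

Fixpoint unpair (n : nat) : nat * nat :=
  match n with
  | 0 => (0, 0)
  | S n' => let (x, y) := unpair n' in
            match x with
            | 0 => (S y, 0)
            | S x' => (x', S y)
            end
  end.

Definition nset := nat -> Prop.

Inductive prog : Type :=
| PZero : prog
| PSucc : prog
| PFst  : prog
| PSnd  : prog
| POracle : prog
| PComp : prog -> prog -> prog
| PPair : prog -> prog -> prog
| PRec  : prog -> prog -> prog
| PMu   : prog -> prog.

Inductive eval (A : nset) : prog -> nat -> nat -> Prop :=
| ev_zero : forall x, eval A PZero x 0
| ev_succ : forall x, eval A PSucc x (S x)
| ev_fst : forall x, eval A PFst x (fst (unpair x))
| ev_snd : forall x, eval A PSnd x (snd (unpair x))
| ev_or1 : forall x, A x -> eval A POracle x 1
| ev_or0 : forall x, ~ A x -> eval A POracle x 0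
| ev_comp : forall f g x w v,
    eval A g x w -> eval A f w v -> eval A (PComp f g) x v
| ev_pair : forall f g x v w,
    eval A f x v -> eval A g x w -> eval A (PPair f g) x (pair v w)
| ev_rec0 : forall f g x v,
    eval A f x v -> eval A (PRec f g) (pair x 0) v
| ev_recS : forall f g x y w v,
    eval A (PRec f g) (pair x y) w ->
    eval A g (pair x (pair y w)) v ->
    eval A (PRec f g) (pair x (S y)) v
| ev_mu : forall f x y,
    eval A f (pair x y) 0 ->
    (forall z, z < y -> exists v, eval A f (pair x z) (S v)) ->
    eval A (PMu f) x y.

Fixpoint code (p : prog) : nat :=
  match p with
  | PZero => pair 0 0
  | PSucc => pair 1 0
  | PFst => pair 2 0
  | PSnd => pair 3 0
  | POracle => pair 4 0
  | PComp f g => pair 5 (pair (code f) (code g))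
  | PPair f g => pair 6 (pair (code f) (code g))
  | PRec f g => pair 7 (pair (code f) (code g))
  | PMu f => pair 8 (code f)
  end.

Definition empty_set : nset := fun _ => False.

Definition b2n (b : Prop) (v : nat) : Prop := (b /\ v = 1) \/ (~ b /\ v = 0).

Definition turing_le (B A : nset) : Prop :=
  exists p, forall x, exists v, eval A p x v /\ b2n (B x) v.

Definition jump (A : nset) : nset :=
  fun e => exists p, code p = e /\ exists v, eval A p e v.

Fixpoint jumpn (n : nat) (A : nset) : nset :=
  match n with
  | 0 => A
  | S m => jump (jumpn m A)
  end.

Definition zero_jump (n : nat) : nset := jumpn n empty_set.

Definition join (X Y : nset) : nset :=
  fun n => if Nat.even n then X (Nat.div2 n) else Y (Nat.div2 n).

(** [omega]^m: m-element subsets of omega, represented as strictly increasing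
    lists of length m. *)
Definition is_mset (m : nat) (s : list nat) : Prop :=
  length s = m /\ StronglySorted lt s.

Fixpoint code_list (s : list nat) : nat :=
  match s with
  | [] => 0
  | x :: l => S (pair x (code_list l))
  end.

(** A coloring f : [omega]^m -> omega (only its values on m-sets matter). *)
Definition coloring := list nat -> nat.

Definition computable_coloring (m : nat) (f : coloring) : Prop :=
  exists p, forall s, is_mset m s -> eval empty_set p (code_list s) (f s).

Definition k_bounded (m k : nat) (f : coloring) : Prop :=
  forall y (l : list (list nat)),
    NoDup l -> (forall s, In s l -> is_mset m s /\ f s = y) -> length l <= k.

Definition infinite (R : nset) : Prop := forall N, exists x, N <= x /\ R x.

Definition rainbow (m : nat) (f : coloring) (R : nset) : Prop :=
  forall s t, is_mset m s -> is_mset m t ->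
    (forall x, In x s -> R x) -> (forall x, In x t -> R x) ->
    f s = f t -> s = t.

(* Main.v *)
(* Write Q for an oracle above 0^(n) with Q' computable in 0^(n+1).

   Exponents are lowered one at a time. If P has PA degree over Q', it computes
   an infinite set along which, for a 2-bounded Q-computable coloring f of
   (m+1)-sets, the truth value of f(s,z) = f(t,z) depends only on s and t. The
   equivalence of s and t so defined has classes of size at most 2, and a rainbow
   for the induced coloring of m-sets gives one for f. By the low basis theorem
   P can be chosen with P' computable in Q'', so after n steps a computable
   coloring of (n+2)-sets becomes a coloring of pairs computable in some Q as above.

   For pairs, build a rainbow D one element at a time, keeping infinitely many z
   with all f(a,z), a in D, distinct. By 2-boundedness at most |D| choices of the
   next element destroy this, and they form a Q'-c.e. set, so a set X that is
   sufficiently random over Q' can choose safely. Randomness also gives that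
   (X + Q)' is computable in X + Q': from Q' one finds a stage after which only a
   small measure of oracles begin to halt. These requirements define a nonempty
   effectively closed class over Q', and a member X given by the low basis theorem
   has (X + Q)'' computable in (X + Q')', hence in Q'', hence in 0^(n+2). *)

From Stdlib Require Import Arith List Sorted Lia Classical ClassicalEpsilon.
Require Import Defs.
Import ListNotations.


(** * Pairing and encodings *)

(** The pair case is not treated by one more exponent reduction because of the count of jumps. For
    [P] of PA degree over Q' the low basis theorem controls only P', by Q'', which is one jump short
    of what low${}_2$ demands. The random step makes good this loss: it never puts Q' below the
    bounding set, and the jump of X + Q stays below X + Q'.

    Both the final Q and X are fixed before any coloring is given. One [P] serves all colorings at
    each reduction, and one X must defeat every Q'-c.e. set of bad choices at once. Such a set is
    indexed by [n = pair c x], where [x] codes the finite rainbow built so far. The code of a finite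
    set bounds its size, so [n] itself is an upper bound on the number of bad choices that is known
    in advance. Prefixes of length [2 * n + 3] then keep the measure lost to the [n]-th set below
    [2 ^ -(n + 3)]; the same is allotted to the oracles on which program [n] halts late. The total
    is at most 1/2, which leaves the closed class nonempty. *)

Lemma pair_S_r x y : pair x (S y) = S (pair (S x) y).
Proof. unfold pair. replace (S x + y) with (x + S y) by lia. lia. Qed.

Lemma pair_S_0 y : pair (S y) 0 = S (pair 0 y).
Proof.
  unfold pair.
  replace ((S y + 0) * (S y + 0 + 1)) with ((0 + y) * (0 + y + 1) + (y + 1) * 2) by lia.
  rewrite Nat.div_add by lia. lia.
Qed.

(** [unpair] walks along the antidiagonals [x + y = s], so the outer induction is on [s] and the
    inner one on [y]. *)
Lemma unpair_pair x y : unpair (pair x y) = (x, y).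
Proof.
  remember (x + y) as s eqn:Hs. revert y x Hs.
  induction s as [|s IHs]; intros y.
  - intros x H. replace x with 0 by lia. now replace y with 0 by lia.
  - induction y as [|y IHy]; intros x H.
    + destruct x as [|x]; [lia|]. rewrite pair_S_0. simpl.
      rewrite (IHs x 0) by lia. reflexivity.
    + rewrite pair_S_r. simpl. rewrite (IHy (S x)) by lia. reflexivity.
Qed.

Lemma pair_unpair n : pair (fst (unpair n)) (snd (unpair n)) = n.
Proof.
  induction n as [|n IH]; [reflexivity|]. simpl.
  destruct (unpair n) as [[|x] y]; simpl in *.
  - now rewrite pair_S_0, IH.
  - now rewrite pair_S_r, IH.
Qed.

Lemma pair_inj x y x' y' : pair x y = pair x' y' -> x = x' /\ y = y'.
Proof.
  intros H. assert (E : unpair (pair x y) = unpair (pair x' y')) by now rewrite H.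
  rewrite !unpair_pair in E. now inversion E.
Qed.

Lemma pair_le_l x y : x <= pair x y.
Proof.
  unfold pair. assert (H := Nat.div_le_lower_bound ((x + y) * (x + y + 1)) 2 (x + y)).
  destruct (Nat.eq_dec (x + y) 0); [lia|]. enough (x + y <= (x + y) * (x + y + 1) / 2) by lia.
  apply H; nia.
Qed.

Lemma pair_le_r x y : y <= pair x y.
Proof. unfold pair. lia. Qed.

Lemma pair_mono x y x' y' : x <= x' -> y <= y' -> pair x y <= pair x' y'.
Proof.
  intros H1 H2. unfold pair.
  enough ((x + y) * (x + y + 1) / 2 <= (x' + y') * (x' + y' + 1) / 2) by lia.
  apply Nat.Div0.div_le_mono. nia.
Qed.

Lemma unpair_snd_le n : snd (unpair n) <= n.
Proof. rewrite <- (pair_unpair n) at 2. apply pair_le_r. Qed.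

(** Encodings are bijections with [nat]. Hence [dec] is computed by a program for the identity, and
    a search through all codes is a search through [T]. *)
Class Enc (T : Type) := {
  enc : T -> nat;
  dec : nat -> T;
  dec_enc : forall x, dec (enc x) = x;
  enc_dec : forall n, enc (dec n) = n }.

Lemma enc_inj {T} `{Enc T} (x y : T) : enc x = enc y -> x = y.
Proof. intros E. now rewrite <- (dec_enc x), <- (dec_enc y), E. Qed.

#[export, refine] Instance EncNat : Enc nat := {| enc := fun n => n; dec := fun n => n |}.
Proof. all: reflexivity. Defined.

#[export, refine] Instance EncProd {T U} `{Enc T} `{Enc U} : Enc (T * U) :=
  {| enc := fun t => pair (enc (fst t)) (enc (snd t));
     dec := fun n => (dec (fst (unpair n)), dec (snd (unpair n))) |}.
Proof.
  - intros [x y]. rewrite unpair_pair. simpl. now rewrite !dec_enc.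
  - intros n. simpl. rewrite !enc_dec. apply pair_unpair.
Defined.

Fixpoint decode_list (fuel n : nat) : list nat :=
  match fuel, n with
  | S fuel, S n => fst (unpair n) :: decode_list fuel (snd (unpair n))
  | _, _ => []
  end.

Lemma code_decode_list fuel n : n <= fuel -> code_list (decode_list fuel n) = n.
Proof.
  revert n. induction fuel as [|fuel IH]; intros [|n] H; try (simpl; lia).
  simpl. rewrite IH; [now rewrite pair_unpair|].
  pose proof (unpair_snd_le n). lia.
Qed.

Lemma decode_code_list fuel l : code_list l <= fuel -> decode_list fuel (code_list l) = l.
Proof.
  revert l. induction fuel as [|fuel IH]; intros [|x l] H; try (simpl in *; lia); try reflexivity.
  simpl in *. rewrite unpair_pair. simpl. f_equal. apply IH.
  pose proof (pair_le_r x (code_list l)). lia.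
Qed.

#[export, refine] Instance EncList {T} `{Enc T} : Enc (list T) :=
  {| enc := fun l => code_list (map enc l); dec := fun n => map dec (decode_list n n) |}.
Proof.
  - intros l. rewrite decode_code_list by lia. rewrite map_map.
    rewrite (map_ext _ (fun x => x)), map_id; [reflexivity|]. apply dec_enc.
  - intros n. rewrite map_map. rewrite (map_ext _ (fun x => x)), map_id; [|apply enc_dec].
    now apply code_decode_list.
Defined.

Lemma enc_cons {T} `{Enc T} (a : T) l : enc (a :: l) = S (pair (enc a) (enc l)).
Proof. reflexivity. Qed.

Lemma enc_list_nat (l : list nat) : enc l = code_list l.
Proof. simpl. f_equal. apply map_id. Qed.

Lemma length_le_enc {T} `{Enc T} (l : list T) : length l <= enc l.
Proof.
  induction l as [|a l IH]; [simpl; lia|]. rewrite enc_cons. simpl length.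
  pose proof (pair_le_r (enc a) (enc l)). lia.
Qed.

Lemma In_enc_lt {T} `{Enc T} (a : T) l : In a l -> enc a < enc l.
Proof.
  induction l as [|b l IH]; [easy|]. rewrite enc_cons.
  intros [->|Hi]; [pose proof (pair_le_l (enc a) (enc l)); lia|].
  pose proof (pair_le_r (enc b) (enc l)). specialize (IH Hi). lia.
Qed.

#[global] Opaque pair unpair.

(** * Computable functions and decidable predicates *)

Definition computable (A : nset) {T U} `{Enc T} `{Enc U} (f : T -> U) : Prop :=
  exists p, forall x, eval A p (enc x) (enc (f x)).

Definition chi (P : Prop) : nat := if excluded_middle_informative P then 1 else 0.

Definition decid (A : nset) {T} `{Enc T} (P : T -> Prop) : Prop :=
  computable A (fun x => chi (P x)).

Lemma chi_true (P : Prop) : P -> chi P = 1.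
Proof. unfold chi. now destruct excluded_middle_informative. Qed.

Lemma chi_false (P : Prop) : ~ P -> chi P = 0.
Proof. unfold chi. now destruct excluded_middle_informative. Qed.

Lemma chi_spec (P : Prop) : b2n P (chi P).
Proof. unfold chi, b2n. destruct excluded_middle_informative; auto. Qed.

Lemma chi_iff (P Q : Prop) : (P <-> Q) -> chi P = chi Q.
Proof. intros H. unfold chi. destruct (excluded_middle_informative P), (excluded_middle_informative Q); tauto. Qed.

Lemma b2n_chi (P : Prop) v : b2n P v -> v = chi P.
Proof. intros [[H ->]|[H ->]]; [now rewrite chi_true | now rewrite chi_false]. Qed.

Lemma chi_le_1 P : chi P <= 1.
Proof. unfold chi. destruct excluded_middle_informative; lia. Qed.

Section Closure.
Context (A : nset).
Context {T U V : Type} `{Enc T} `{Enc U} `{Enc V}.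

Lemma comp_ext (f g : T -> U) : (forall x, f x = g x) -> computable A f -> computable A g.
Proof. intros E [p Hp]. exists p. intros x. now rewrite <- E. Qed.

Lemma decid_ext (P Q : T -> Prop) : (forall x, P x <-> Q x) -> decid A P -> decid A Q.
Proof. intros E [p Hp]. exists p. intros x. now rewrite <- (chi_iff _ _ (E x)). Qed.

Lemma eval_id x : eval A (PPair PFst PSnd) x x.
Proof. rewrite <- (pair_unpair x) at 2. apply ev_pair; constructor. Qed.

Lemma comp_id : computable A (fun x : T => x).
Proof. exists (PPair PFst PSnd). intros x. apply eval_id. Qed.

Lemma comp_app (f : T -> U) (g : U -> V) :
  computable A g -> computable A f -> computable A (fun x => g (f x)).
Proof. intros [q Hq] [p Hp]. exists (PComp q p). intros x. eapply ev_comp; eauto. Qed.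

Fixpoint cst (n : nat) : prog :=
  match n with 0 => PZero | S n => PComp PSucc (cst n) end.

Lemma eval_cst n x : eval A (cst n) x n.
Proof. induction n; simpl; econstructor; eauto. constructor. Qed.

Lemma comp_const (c : U) : computable A (fun _ : T => c).
Proof. exists (cst (enc c)). intros x. apply eval_cst. Qed.

Lemma comp_fst (f : T -> U * V) : computable A f -> computable A (fun x => fst (f x)).
Proof.
  intros [p Hp]. exists (PComp PFst p). intros x. eapply ev_comp; [apply Hp|].
  replace (enc (fst (f x))) with (fst (unpair (enc (f x)))); [constructor|].
  simpl. now rewrite unpair_pair.
Qed.

Lemma comp_snd (f : T -> U * V) : computable A f -> computable A (fun x => snd (f x)).
Proof.
  intros [p Hp]. exists (PComp PSnd p). intros x. eapply ev_comp; [apply Hp|].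
  replace (enc (snd (f x))) with (snd (unpair (enc (f x)))); [constructor|].
  simpl. now rewrite unpair_pair.
Qed.

Lemma comp_mkpair (f : T -> U) (g : T -> V) :
  computable A f -> computable A g -> computable A (fun x => (f x, g x)).
Proof. intros [p Hp] [q Hq]. exists (PPair p q). intros x. now apply ev_pair. Qed.

Lemma comp_pair (f g : T -> nat) :
  computable A f -> computable A g -> computable A (fun x => pair (f x) (g x)).
Proof. intros [p Hp] [q Hq]. exists (PPair p q). intros x. now apply ev_pair. Qed.

Lemma comp_unpair (f : T -> nat) : computable A f -> computable A (fun x => unpair (f x)).
Proof.
  intros [p Hp]. exists p. intros x. specialize (Hp x). simpl in *. now rewrite pair_unpair.
Qed.

Lemma comp_S (f : T -> nat) : computable A f -> computable A (fun x => S (f x)).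
Proof. intros [p Hp]. exists (PComp PSucc p). intros x. eapply ev_comp; [apply Hp|constructor]. Qed.

Lemma comp_enc (f : T -> U) : computable A f -> computable A (fun x => enc (f x)).
Proof. intros [p Hp]. now exists p. Qed.

Lemma comp_dec (f : T -> nat) : computable A f -> computable A (fun x => dec (f x) : U).
Proof. intros [p Hp]. exists p. intros x. rewrite enc_dec. apply Hp. Qed.

End Closure.

Lemma decid_app A {T U} `{Enc T} `{Enc U} (f : T -> U) (P : U -> Prop) :
  decid A P -> computable A f -> decid A (fun x => P (f x)).
Proof. intros HP Hf. exact (comp_app A f (fun u => chi (P u)) HP Hf). Qed.

Ltac prj := repeat first [apply comp_id | eapply comp_fst | eapply comp_snd].

Lemma comp_rec A {T U} `{Enc T} `{Enc U} (b : T -> U) (st : T -> nat -> U -> U) (n : T -> nat) :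
  computable A b ->
  computable A (fun t : T * (nat * U) => st (fst t) (fst (snd t)) (snd (snd t))) ->
  computable A n ->
  computable A (fun x => nat_rect (fun _ => U) (b x) (fun i r => st x i r) (n x)).
Proof.
  intros [p Hp] [q Hq] [r Hr].
  exists (PComp (PRec p q) (PPair (PPair PFst PSnd) r)). intros x.
  eapply ev_comp; [apply ev_pair; [apply eval_id | apply Hr]|].
  change (enc (n x)) with (n x). induction (n x) as [|k IH]; simpl nat_rect.
  - now apply ev_rec0.
  - eapply ev_recS; [apply IH|]. exact (Hq (x, (k, nat_rect _ (b x) (fun i r => st x i r) k))).
Qed.

Lemma comp_case A {T U} `{Enc T} `{Enc U} (a : T -> U) (b : T -> nat -> U) (n : T -> nat) :
  computable A a -> computable A (fun t : T * nat => b (fst t) (snd t)) -> computable A n ->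
  computable A (fun x => match n x with 0 => a x | S k => b x k end).
Proof.
  intros Ha Hb Hn.
  apply comp_ext with (fun x => nat_rect (fun _ => U) (a x) (fun i _ => b x i) (n x)).
  - intros x. now destruct (n x).
  - apply (comp_rec A a (fun x i _ => b x i) n); auto.
    apply (comp_app A (fun t : T * (nat * U) => (fst t, fst (snd t))) (fun t => b (fst t) (snd t)) Hb).
    apply comp_mkpair; [prj | prj].
Qed.

Lemma comp_ite A {T U} `{Enc T} `{Enc U} (P : T -> Prop) (f g : T -> U) :
  decid A P -> computable A f -> computable A g ->
  computable A (fun x => if excluded_middle_informative (P x) then f x else g x).
Proof.
  intros HP Hf Hg.
  apply comp_ext with (fun x => match chi (P x) with 0 => g x | S _ => f x end).
  - intros x. unfold chi. now destruct excluded_middle_informative.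
  - apply (comp_case A g (fun x _ => f x) (fun x => chi (P x))); auto.
    apply (comp_app A (fun t : T * nat => fst t) f Hf). prj.
Qed.

Lemma decid_const A {T} `{Enc T} (P : Prop) : decid A (fun _ : T => P).
Proof. exact (comp_const A (chi P)). Qed.

Lemma decid_not A {T} `{Enc T} (P : T -> Prop) : decid A P -> decid A (fun x => ~ P x).
Proof.
  intros HP. apply comp_ext with (fun x => match chi (P x) with 0 => 1 | S _ => 0 end).
  - intros x. destruct (classic (P x)) as [h|h]; [rewrite (chi_true _ h) | rewrite (chi_false _ h)].
    + now rewrite chi_false by tauto.
    + now rewrite chi_true by tauto.
  - apply (comp_case A (fun _ => 1) (fun _ _ => 0)); auto; apply comp_const.
Qed.

Lemma decid_and A {T} `{Enc T} (P Q : T -> Prop) :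
  decid A P -> decid A Q -> decid A (fun x => P x /\ Q x).
Proof.
  intros HP HQ. apply comp_ext with (fun x => if excluded_middle_informative (P x) then chi (Q x) else 0).
  - intros x. destruct excluded_middle_informative as [h|h].
    + apply chi_iff. tauto.
    + now rewrite chi_false by tauto.
  - apply comp_ite; auto. apply comp_const.
Qed.

Lemma decid_imp A {T} `{Enc T} (P Q : T -> Prop) :
  decid A P -> decid A Q -> decid A (fun x => P x -> Q x).
Proof.
  intros HP HQ. apply decid_ext with (fun x => ~ (P x /\ ~ Q x)); [intros; tauto|].
  now apply decid_not, decid_and, decid_not.
Qed.

Lemma decid_or A {T} `{Enc T} (P Q : T -> Prop) :
  decid A P -> decid A Q -> decid A (fun x => P x \/ Q x).
Proof.
  intros HP HQ. apply decid_ext with (fun x => ~ P x -> Q x); [intros; tauto|].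
  now apply decid_imp; [apply decid_not|].
Qed.

Lemma decid_iff A {T} `{Enc T} (P Q : T -> Prop) :
  decid A P -> decid A Q -> decid A (fun x => P x <-> Q x).
Proof. intros HP HQ. apply decid_and; now apply decid_imp. Qed.

Lemma decid_bex A {T} `{Enc T} (P : T -> nat -> Prop) (n : T -> nat) :
  decid A (fun t : T * nat => P (fst t) (snd t)) -> computable A n ->
  decid A (fun x => exists i, i < n x /\ P x i).
Proof.
  intros HP Hn.
  apply comp_ext with (fun x => nat_rect (fun _ => nat) 0
     (fun i r => match r with 0 => chi (P x i) | S _ => 1 end) (n x)).
  - intros x. induction (n x) as [|k IH]; simpl.
    + rewrite chi_false; auto. intros [i [h _]]. lia.
    + rewrite IH. destruct (classic (exists i, i < k /\ P x i)) as [h|h].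
      * rewrite (chi_true _ h), chi_true; auto. destruct h as [i h]. exists i. intuition lia.
      * rewrite (chi_false _ h). apply chi_iff. split; [intros h'; exists k; auto|].
        intros [i [hi h']]. destruct (Nat.eq_dec i k) as [->|]; auto.
        exfalso. apply h. exists i. split; [lia|auto].
  - apply comp_rec with (b := fun _ : T => 0)
      (st := fun x i r => match r with 0 => chi (P x i) | S _ => 1 end); auto using comp_const.
    apply (comp_case A (fun t : T * (nat * nat) => chi (P (fst t) (fst (snd t)))) (fun _ _ => 1)).
    + apply (comp_app A (fun t : T * (nat * nat) => (fst t, fst (snd t))) (fun t => chi (P (fst t) (snd t))) HP).
      apply comp_mkpair; [prj | prj].
    + apply comp_const.
    + prj.
Qed.

Lemma decid_ball A {T} `{Enc T} (P : T -> nat -> Prop) (n : T -> nat) :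
  decid A (fun t : T * nat => P (fst t) (snd t)) -> computable A n ->
  decid A (fun x => forall i, i < n x -> P x i).
Proof.
  intros HP Hn. apply decid_ext with (fun x => ~ exists i, i < n x /\ ~ P x i).
  - intros x. split; [|firstorder].
    intros h i hi. apply NNPP. intros h'. apply h. eauto.
  - apply decid_not, decid_bex; auto. now apply decid_not in HP.
Qed.

Lemma comp_pred A {T} `{Enc T} (f : T -> nat) : computable A f -> computable A (fun x => pred (f x)).
Proof.
  intros Hf. apply comp_ext with (fun x => match f x with 0 => 0 | S k => k end).
  - intros x. now destruct (f x).
  - apply (comp_case A (fun _ => 0) (fun _ k => k)); auto; [apply comp_const | prj].
Qed.

Lemma comp_add A {T} `{Enc T} (f g : T -> nat) :
  computable A f -> computable A g -> computable A (fun x => f x + g x).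
Proof.
  intros Hf Hg. apply comp_ext with (fun x => nat_rect (fun _ => nat) (f x) (fun _ r => S r) (g x)).
  - intros x. induction (g x) as [|k IH]; simpl; [lia|]. rewrite IH. lia.
  - apply comp_rec with (st := fun _ _ r => S r); auto. apply comp_S; prj.
Qed.

Lemma comp_sub A {T} `{Enc T} (f g : T -> nat) :
  computable A f -> computable A g -> computable A (fun x => f x - g x).
Proof.
  intros Hf Hg. apply comp_ext with (fun x => nat_rect (fun _ => nat) (f x) (fun _ r => pred r) (g x)).
  - intros x. induction (g x) as [|k IH]; simpl; [lia|]. rewrite IH. lia.
  - apply comp_rec with (st := fun _ _ r => pred r); auto. apply comp_pred; prj.
Qed.

Lemma comp_mul A {T} `{Enc T} (f g : T -> nat) :
  computable A f -> computable A g -> computable A (fun x => f x * g x).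
Proof.
  intros Hf Hg. apply comp_ext with (fun x => nat_rect (fun _ => nat) 0 (fun _ r => f x + r) (g x)).
  - intros x. induction (g x) as [|k IH]; simpl; [lia|]. rewrite IH. lia.
  - apply comp_rec with (b := fun _ => 0) (st := fun x _ r => f x + r); auto using comp_const.
    apply comp_add; [|prj].
    apply (comp_app A (fun t : T * (nat * nat) => fst t) f Hf). prj.
Qed.

Lemma comp_pow2 A {T} `{Enc T} (f : T -> nat) : computable A f -> computable A (fun x => 2 ^ f x).
Proof.
  intros Hf. apply comp_ext with (fun x => nat_rect (fun _ => nat) 1 (fun _ r => r + r) (f x)).
  - intros x. induction (f x) as [|k IH]; simpl; [lia|]. rewrite IH. lia.
  - apply comp_rec with (b := fun _ => 1) (st := fun _ _ r => r + r); auto using comp_const.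
    apply comp_add; prj.
Qed.

Lemma decid_eq0 A {T} `{Enc T} (f : T -> nat) : computable A f -> decid A (fun x => f x = 0).
Proof.
  intros Hf. apply comp_ext with (fun x => match f x with 0 => 1 | S _ => 0 end).
  - intros x. destruct (f x); [now rewrite chi_true|now rewrite chi_false].
  - apply (comp_case A (fun _ => 1) (fun _ _ => 0)); auto; apply comp_const.
Qed.

Lemma decid_le A {T} `{Enc T} (f g : T -> nat) :
  computable A f -> computable A g -> decid A (fun x => f x <= g x).
Proof.
  intros Hf Hg. apply decid_ext with (fun x => f x - g x = 0); [intros; lia|].
  now apply decid_eq0, comp_sub.
Qed.

Lemma decid_lt A {T} `{Enc T} (f g : T -> nat) :
  computable A f -> computable A g -> decid A (fun x => f x < g x).
Proof. intros Hf Hg. now apply decid_le; [apply comp_S|]. Qed.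

Lemma decid_eq A {T U} `{Enc T} `{Enc U} (f g : T -> U) :
  computable A f -> computable A g -> decid A (fun x => f x = g x).
Proof.
  intros Hf Hg. apply decid_ext with (fun x => enc (f x) <= enc (g x) /\ enc (g x) <= enc (f x)).
  - intros x. split; [intros h; apply enc_inj; lia|]. intros ->. lia.
  - apply decid_and; (apply decid_le; (now eapply comp_enc)).
Qed.

(* [cpt] and [dcd] follow the syntax of the function or predicate; these two
   hooks are redefined when lists are available. *)
Ltac cpt_user := fail.
Ltac dcd_user := fail.

Ltac cpt :=
  cbn beta;
  lazymatch goal with
  | |- computable ?A (fun x => x) => apply comp_id
  | |- computable ?A (fun _ => ?c) => apply comp_const
  | H : computable ?A ?f |- computable ?A ?f => exact H
  | |- computable ?A (fun x => chi (@?P x)) => change (decid A P); dcd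
  | |- computable ?A (fun x => fst (@?f x)) => eapply comp_fst; cpt
  | |- computable ?A (fun x => snd (@?f x)) => eapply comp_snd; cpt
  | |- computable ?A (fun x => (@?f x, @?g x)) => apply comp_mkpair; cpt
  | |- computable ?A (fun x => pair (@?f x) (@?g x)) => apply comp_pair; cpt
  | |- computable ?A (fun x => unpair (@?f x)) => apply comp_unpair; cpt
  | |- computable ?A (fun x => S (@?f x)) => apply comp_S; cpt
  | |- computable ?A (fun x => enc (@?f x)) => eapply comp_enc; cpt
  | |- computable ?A (fun x => dec (@?f x)) => apply comp_dec; cpt
  | |- computable ?A (fun x => pred (@?f x)) => apply comp_pred; cpt
  | |- computable ?A (fun x => @?f x + @?g x) => apply comp_add; cpt
  | |- computable ?A (fun x => @?f x - @?g x) => apply comp_sub; cpt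
  | |- computable ?A (fun x => @?f x * @?g x) => apply comp_mul; cpt
  | |- computable ?A (fun x => 2 ^ @?f x) => apply comp_pow2; cpt
  | |- computable ?A (fun x => if excluded_middle_informative (@?P x) then @?f x else @?g x) =>
      apply (comp_ite A P f g); [dcd|cpt|cpt]
  | |- computable ?A (fun x => match @?n x with 0 => @?a x | S k => @?b x k end) =>
      apply (comp_case A a b n); cpt
  | |- computable ?A (fun x => nat_rect _ (@?b x) (@?s x) (@?n x)) =>
      apply (comp_rec A b s n); cpt
  | H : computable ?A ?f |- computable ?A (fun x => ?f (@?g x)) => apply (comp_app A g f H); cpt
  | H : computable ?A ?f |- computable ?A ?f => exact H
  | H : computable ?A (fun t => ?f (fst t) (snd t)) |- computable ?A (fun x => ?f (@?g x) (@?h x)) =>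
      refine (comp_app A (fun x => (g x, h x)) (fun t => f (fst t) (snd t)) H _); cpt
  | |- computable _ (fun _ => _) => cpt_user; cpt
  | |- computable ?A ?f => change (computable A (fun x => f x)); cpt
  end
with dcd :=
  cbn beta;
  lazymatch goal with
  | |- decid ?A (fun _ => ?c) => apply decid_const
  | H : decid ?A ?P |- decid ?A ?P => exact H
  | |- decid ?A (fun x => ~ (@?P x)) => apply decid_not; dcd
  | |- decid ?A (fun x => @?P x /\ @?Q x) => apply (decid_and A P Q); dcd
  | |- decid ?A (fun x => @?P x \/ @?Q x) => apply (decid_or A P Q); dcd
  | |- decid ?A (fun x => @?P x <-> @?Q x) => apply (decid_iff A P Q); dcd
  | |- decid ?A (fun x => exists i, i < @?n x /\ @?P x i) => apply (decid_bex A P n); [dcd|cpt]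
  | |- decid ?A (fun x => forall i, i < @?n x -> @?P x i) => apply (decid_ball A P n); [dcd|cpt]
  | |- decid ?A (fun x => @?P x -> @?Q x) => apply (decid_imp A P Q); dcd
  | |- decid ?A (fun x => @?f x <= @?g x) => apply (decid_le A f g); cpt
  | |- decid ?A (fun x => @?f x < @?g x) => apply (decid_lt A f g); cpt
  | |- decid ?A (fun x => @?f x = @?g x) => apply (decid_eq A f g); cpt
  | H : decid ?A ?P |- decid ?A (fun x => ?P (@?g x)) => apply (decid_app A g P H); cpt
  | H : decid ?A ?P |- decid ?A ?P => exact H
  | H : decid ?A (fun t => ?P (fst t) (snd t)) |- decid ?A (fun x => ?P (@?g x) (@?h x)) =>
      refine (decid_app A (fun x => (g x, h x)) (fun t => P (fst t) (snd t)) H _); cpt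
  | |- decid _ (fun _ => _) => dcd_user; dcd
  | |- decid ?A ?f => change (decid A (fun x => f x)); dcd
  end.

Lemma decid_bex_le A {T} `{Enc T} (P : T -> nat -> Prop) (n : T -> nat) :
  decid A (fun t : T * nat => P (fst t) (snd t)) -> computable A n ->
  decid A (fun x => exists i, i <= n x /\ P x i).
Proof.
  intros HP Hn. apply decid_ext with (fun x => exists i, i < S (n x) /\ P x i).
  - intros x. split; intros [i [h ?]]; exists i; split; auto; lia.
  - dcd.
Qed.

(** * Lists *)

Lemma comp_cons A {T U} `{Enc T} `{Enc U} (a : T -> U) (l : T -> list U) :
  computable A a -> computable A l -> computable A (fun x => a x :: l x).
Proof.
  intros [p Hp] [q Hq]. exists (PComp PSucc (PPair p q)). intros x.
  eapply ev_comp; [apply ev_pair; auto|]. rewrite enc_cons. constructor.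
Qed.

Lemma comp_match_list A {T U V} `{Enc T} `{Enc U} `{Enc V}
    (a : T -> V) (b : T -> U -> list U -> V) (l : T -> list U) :
  computable A a ->
  computable A (fun t : T * (U * list U) => b (fst t) (fst (snd t)) (snd (snd t))) ->
  computable A l ->
  computable A (fun x => match l x with [] => a x | h :: r => b x h r end).
Proof.
  intros Ha Hb Hl.
  apply comp_ext with (fun x => match enc (l x) with 0 => a x
     | S k => b x (dec (fst (unpair k))) (dec (snd (unpair k))) end).
  - intros x. destruct (l x) as [|h r]; [reflexivity|]. rewrite enc_cons, unpair_pair.
    cbn [fst snd]. now rewrite !dec_enc.
  - apply (comp_case A a (fun x k => b x (dec (fst (unpair k))) (dec (snd (unpair k))))
      (fun x => enc (l x))); auto.
    refine (comp_app A (fun t : T * nat => (fst t, (dec (fst (unpair (snd t))) : U,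
        dec (snd (unpair (snd t))) : list U)))
        (fun t => b (fst t) (fst (snd t)) (snd (snd t))) Hb _). cpt.
Qed.

(** A fold is a primitive recursion whose state holds the rest of the list and the accumulator. It
    runs for [enc (l x)] rounds, at least the length of the list; surplus rounds leave the state
    unchanged. *)
Lemma comp_fold_left A {T U V} `{Enc T} `{Enc U} `{Enc V}
    (h : T -> V -> U -> V) (l : T -> list U) (i : T -> V) :
  computable A (fun t : T * (V * U) => h (fst t) (fst (snd t)) (snd (snd t))) ->
  computable A l -> computable A i ->
  computable A (fun x => fold_left (h x) (l x) (i x)).
Proof.
  intros Hh Hl Hi.
  set (st := fun (x : T) (_ : nat) (s : list U * V) =>
    match fst s with [] => s | a :: r => (r, h x (snd s) a) end).
  apply comp_ext with (fun x => snd (nat_rect (fun _ => (list U * V)%type) (l x, i x) (st x) (enc (l x)))).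
  - intros x.
    (* The step ignores its counter, so the first round can be split off in place of the last. *)
    assert (E : forall n s, nat_rect (fun _ => (list U * V)%type) s (st x) (S n)
      = nat_rect (fun _ => (list U * V)%type) (st x 0 s) (st x) n).
    { intros n s. induction n as [|n IH]; [reflexivity|]. simpl in *. now rewrite IH. }
    generalize (length_le_enc (l x)). generalize (enc (l x)). intros n. revert n.
    generalize (i x). induction (l x) as [|a r IH]; intros v n Hn.
    + clear Hn. replace (nat_rect _ _ _ n) with (@nil U, v); [reflexivity|].
      induction n as [|n IHn]; [reflexivity|]. simpl. now rewrite <- IHn.
    + destruct n as [|n]; [simpl in Hn; lia|]. rewrite E. simpl. apply IH. simpl in Hn. lia.
  - eapply comp_snd. apply (comp_rec A (fun x => (l x, i x)) st (fun x => enc (l x))); try cpt.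
    unfold st. apply (comp_match_list A (fun t : T * (nat * (list U * V)) => snd (snd t))
      (fun t a r => (r, h (fst t) (snd (snd (snd t))) a)) (fun t => fst (snd (snd t)))); try cpt.
    apply comp_mkpair; [cpt|].
    refine (comp_app A (fun t : (T * (nat * (list U * V))) * (U * list U) =>
       (fst (fst t), (snd (snd (snd (fst t))), fst (snd t))))
       (fun t => h (fst t) (fst (snd t)) (snd (snd t))) Hh _). cpt.
Qed.

Lemma comp_rev A {T U} `{Enc T} `{Enc U} (l : T -> list U) :
  computable A l -> computable A (fun x => rev (l x)).
Proof.
  intros Hl. apply comp_ext with (fun x => fold_left (fun r a => a :: r) (l x) []).
  - intros x. rewrite <- (app_nil_r (rev (l x))). generalize (@nil U).
    induction (l x) as [|a r IH]; intros m; simpl; [reflexivity|]. now rewrite IH, <- app_assoc.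
  - apply (comp_fold_left A (fun _ r a => a :: r) l (fun _ => [])); try cpt.
    apply comp_cons; cpt.
Qed.

Lemma comp_append A {T U} `{Enc T} `{Enc U} (l m : T -> list U) :
  computable A l -> computable A m -> computable A (fun x => l x ++ m x).
Proof.
  intros Hl Hm. apply comp_ext with (fun x => fold_left (fun r a => a :: r) (rev (l x)) (m x)).
  - intros x. rewrite <- fold_left_rev_right, rev_involutive.
    induction (l x) as [|a r IH]; simpl; [reflexivity|]. now rewrite IH.
  - apply (comp_fold_left A (fun _ r a => a :: r) (fun x => rev (l x)) m); auto using comp_rev.
    apply comp_cons; cpt.
Qed.

Lemma comp_length A {T U} `{Enc T} `{Enc U} (l : T -> list U) :
  computable A l -> computable A (fun x => length (l x)).
Proof.
  intros Hl. apply comp_ext with (fun x => fold_left (fun r _ => S r) (l x) 0).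
  - intros x. enough (forall k, fold_left (fun r (_ : U) => S r) (l x) k = length (l x) + k) as E
      by (rewrite E; lia).
    induction (l x) as [|a r IH]; intros k; simpl; [reflexivity|]. rewrite IH. lia.
  - apply (comp_fold_left A (fun _ r _ => S r) l (fun _ => 0)); cpt.
Qed.

Lemma comp_map A {T U V} `{Enc T} `{Enc U} `{Enc V} (g : T -> U -> V) (l : T -> list U) :
  computable A (fun t : T * U => g (fst t) (snd t)) -> computable A l ->
  computable A (fun x => map (g x) (l x)).
Proof.
  intros Hg Hl. apply comp_ext with (fun x => rev (fold_left (fun r a => g x a :: r) (l x) [])).
  - intros x. rewrite <- (app_nil_l (map (g x) (l x))). change (@nil V) with (rev (@nil V)) at 2.
    generalize (@nil V). induction (l x) as [|a r IH]; intros m; simpl; [now rewrite app_nil_r|].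
    rewrite IH. simpl. now rewrite <- app_assoc.
  - apply comp_rev. apply (comp_fold_left A (fun x r a => g x a :: r) l (fun _ => [])); try cpt.
    apply comp_cons; cpt.
Qed.

Lemma comp_skipn A {T U} `{Enc T} `{Enc U} (n : T -> nat) (l : T -> list U) :
  computable A n -> computable A l -> computable A (fun x => skipn (n x) (l x)).
Proof.
  intros Hn Hl. apply comp_ext with (fun x => nat_rect (fun _ => list U) (l x)
     (fun _ r => match r with [] => [] | _ :: r' => r' end) (n x)).
  - intros x. induction (n x) as [|k IH]; [reflexivity|]. simpl nat_rect. rewrite IH.
    generalize (l x). clear. induction k as [|k IH]; intros [|a m]; try reflexivity.

    + simpl. now rewrite IH.
  - apply (comp_rec A l (fun _ _ r => match r with [] => [] | _ :: r' => r' end) n); auto.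
    apply (comp_match_list A (fun _ => []) (fun _ _ r => r)); cpt.
Qed.

Lemma decid_bex_list A {T U} `{Enc T} `{Enc U} (P : T -> U -> Prop) (l : T -> list U) :
  decid A (fun t : T * U => P (fst t) (snd t)) -> computable A l ->
  decid A (fun x => exists a, In a (l x) /\ P x a).
Proof.
  intros HP Hl.
  apply comp_ext with (fun x => fold_left (fun r a => match r with 0 => chi (P x a) | S _ => 1 end) (l x) 0).
  - intros x.
    assert (E1 : forall m, fold_left (fun r a => match r with 0 => chi (P x a) | S _ => 1 end) m 1 = 1).
    { induction m; simpl; auto. }
    induction (l x) as [|a r IH]; simpl.
    + rewrite chi_false; auto. now intros [a [[] _]].
    + destruct (classic (P x a)) as [h|h].
      * rewrite (chi_true _ h), E1, chi_true; auto. exists a. auto.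
      * rewrite (chi_false _ h), IH. apply chi_iff. split.
        -- intros [b [? ?]]; eauto.
        -- intros [b [[->|?] ?]]; [tauto|eauto].
  - apply (comp_fold_left A (fun x r a => match r with 0 => chi (P x a) | S _ => 1 end) l (fun _ => 0)); cpt.
Qed.

Lemma decid_ball_list A {T U} `{Enc T} `{Enc U} (P : T -> U -> Prop) (l : T -> list U) :
  decid A (fun t : T * U => P (fst t) (snd t)) -> computable A l ->
  decid A (fun x => forall a, In a (l x) -> P x a).
Proof.
  intros HP Hl. apply decid_ext with (fun x => ~ exists a, In a (l x) /\ ~ P x a).
  - intros x. split; [|firstorder].
    intros h a ha. apply NNPP. intros h'. apply h. eauto.
  - apply decid_not. apply (decid_bex_list A (fun x a => ~ P x a) l); auto. dcd.
Qed.

Lemma decid_In A {T U} `{Enc T} `{Enc U} (a : T -> U) (l : T -> list U) :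
  computable A a -> computable A l -> decid A (fun x => In (a x) (l x)).
Proof.
  intros Ha Hl. apply decid_ext with (fun x => exists b, In b (l x) /\ b = a x).
  - intros x. split; [intros [b [? <-]]; auto | eauto].
  - apply (decid_bex_list A (fun x b => b = a x) l); auto. dcd.
Qed.

(** Each entry is tested against the entries after it. Sortedness has this shape, and so do
    certificates of computations, where an entry may rely only on later ones. *)
Fixpoint all_suffixes {U} (J : U -> list U -> Prop) (l : list U) : Prop :=
  match l with [] => True | a :: r => J a r /\ all_suffixes J r end.

Lemma decid_all_suffixes A {T U} `{Enc T} `{Enc U} (J : U -> list U -> Prop) (l : T -> list U) :
  decid A (fun t : U * list U => J (fst t) (snd t)) -> computable A l ->
  decid A (fun x => all_suffixes J (l x)).
Proof.
  intros HJ Hl.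
  (* Positions past the end give the empty suffix, where the default 1 satisfies the test. *)
  apply decid_ext with (fun x => forall i, i < enc (l x) ->
    match skipn i (l x) with [] => 1 | a :: r => chi (J a r) end = 1).
  - intros x.
    transitivity (forall i, match skipn i (l x) with [] => 1 | a :: r => chi (J a r) end = 1).
    { split; [|auto]. intros h i. destruct (Nat.lt_ge_cases i (enc (l x))) as [?|hi]; auto.
      rewrite skipn_all2; auto. pose proof (length_le_enc (l x)). lia. }
    induction (l x) as [|a r IH]; simpl.
    + split; auto. intros _ i. now rewrite skipn_nil.
    + rewrite <- IH. split.
      * intros h. split; [|intros i; apply (h (S i))]. specialize (h 0). simpl in h.
        apply NNPP. intros h'. rewrite chi_false in h; easy.
      * intros [h1 h2] [|i]; [now apply chi_true|]. apply h2.
  - apply (decid_ball A (fun x i => match skipn i (l x) with [] => 1 | a :: r => chi (J a r) end = 1)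
      (fun x => enc (l x))); [|cpt].
    eapply decid_eq; [|cpt].
    apply (comp_match_list A (fun _ => 1) (fun _ a r => chi (J a r)) (fun t : T * nat => skipn (snd t) (l (fst t)))); try cpt.
    apply comp_skipn; cpt.
Qed.

Lemma StronglySorted_all_suffixes (l : list nat) :
  StronglySorted lt l <-> all_suffixes (fun a r => forall b, In b r -> a < b) l.
Proof.
  induction l as [|a r IH]; simpl; [split; constructor|]. rewrite <- IH. split.
  - intros h. inversion h; subst. now rewrite Forall_forall in *.
  - intros [h1 h2]. constructor; auto. now apply Forall_forall.
Qed.

Ltac cpt_user ::=
  lazymatch goal with
  | |- computable ?A (fun x => @?a x :: @?l x) => apply (comp_cons A a l); cpt
  | |- computable ?A (fun x => @?l x ++ @?m x) => apply (comp_append A l m); cpt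
  | |- computable ?A (fun x => rev (@?l x)) => apply (comp_rev A l); cpt
  | |- computable ?A (fun x => length (@?l x)) => apply (comp_length A l); cpt
  | |- computable ?A (fun x => map (@?g x) (@?l x)) => apply (comp_map A g l); cpt
  | |- computable ?A (fun x => fold_left (@?h x) (@?l x) (@?i x)) => apply (comp_fold_left A h l i); cpt
  | |- computable ?A (fun x => match @?l x with [] => @?a x | h :: r => @?b x h r end) =>
      apply (comp_match_list A a b l); cpt
  | _ => fail
  end.

Ltac dcd_user ::=
  lazymatch goal with
  | |- decid ?A (fun x => exists i, i <= @?n x /\ @?P x i) => apply (decid_bex_le A P n); [dcd|cpt]
  | |- decid ?A (fun x => exists a, In a (@?l x) /\ @?P x a) => apply (decid_bex_list A P l); [dcd|cpt]
  | |- decid ?A (fun x => forall a, In a (@?l x) -> @?P x a) => apply (decid_ball_list A P l); [dcd|cpt]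
  | |- decid ?A (fun x => In (@?a x) (@?l x)) => apply (decid_In A a l); cpt
  | |- decid ?A (fun x => all_suffixes ?J (@?l x)) => apply (decid_all_suffixes A J l); [dcd|cpt]
  | _ => fail
  end.

Lemma decid_is_mset A {T} `{Enc T} (m : T -> nat) (s : T -> list nat) :
  computable A m -> computable A s -> decid A (fun x => is_mset (m x) (s x)).
Proof.
  intros Hm Hs.
  apply decid_ext with (fun x => length (s x) = m x /\
    all_suffixes (fun a r => forall b, In b r -> a < b) (s x)).
  - intros x. unfold is_mset. now rewrite StronglySorted_all_suffixes.
  - dcd.
Qed.

(** * Search and iteration *)

Lemma least_exists (P : nat -> Prop) :
  (exists n, P n) -> exists n, P n /\ forall m, m < n -> ~ P m.
Proof.
  intros [n Hn]. revert Hn. induction n as [n IH] using lt_wf_ind. intros Hn.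
  destruct (classic (exists m, m < n /\ P m)) as [[m [? ?]]|h]; [eauto|].
  exists n. split; auto. intros m hm hp. apply h. eauto.
Qed.

(** One program searches for all [x] and may diverge where there is no witness, which allows
    searches whose success is known only under an undecidable hypothesis. *)
Lemma eval_search A {T U} `{Enc T} `{Enc U} (R : T -> U -> Prop) :
  decid A (fun t : T * U => R (fst t) (snd t)) ->
  exists q, forall x, (exists u, R x u) -> exists u, R x u /\ eval A q (enc x) (enc u).
Proof.
  intros HR.
  assert (HC : computable A (fun t : T * nat => 1 - chi (R (fst t) (dec (snd t))))).
  { apply comp_sub; [cpt|].
    refine (decid_app A (fun t : T * nat => (fst t, dec (snd t) : U)) (fun t => R (fst t) (snd t)) HR _). cpt. }
  destruct HC as [p Hp]. exists (PMu p). intros x Hx.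
  destruct (least_exists (fun n => R x (dec n))) as [n [Hn Hmin]].
  { destruct Hx as [u Hu]. exists (enc u). now rewrite dec_enc. }
  exists (dec n). split; auto. rewrite enc_dec. apply ev_mu.
  - specialize (Hp (x, n)). cbn [fst snd] in Hp. now rewrite chi_true in Hp.
  - intros z Hz. exists 0. specialize (Hp (x, z)). cbn [fst snd] in Hp.
    rewrite chi_false in Hp by auto. exact Hp.
Qed.

Lemma comp_select A {T U} `{Enc T} `{Enc U} (R : T -> U -> Prop) :
  decid A (fun t : T * U => R (fst t) (snd t)) -> (forall x, exists u, R x u) ->
  exists f, computable A f /\ forall x, R x (f x).
Proof.
  intros HR Hex. destruct (eval_search A R HR) as [q Hq].
  destruct (choice (fun x u => R x u /\ eval A q (enc x) (enc u))) as [f Hf].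
  { intros x. apply Hq, Hex. }
  exists f. split; [exists q|]; intros x; apply Hf.
Qed.

Lemma comp_graph A {T U} `{Enc T} `{Enc U} (f : T -> U) :
  decid A (fun t : T * U => f (fst t) = snd t) -> computable A f.
Proof.
  intros HR. destruct (comp_select A (fun x u => f x = u) HR) as [g [Hg E]]; [eauto|].
  apply comp_ext with g; auto.
Qed.

(** The invariant is arbitrary and never tested by the program; it only guarantees that each search
    along the orbit succeeds. Off the invariant [nx] takes a meaningless value. *)
Lemma comp_iterate A {U} `{Enc U} (step : U -> U -> Prop) (inv : U -> Prop) (u0 : U) :
  decid A (fun t : U * U => step (fst t) (snd t)) -> inv u0 ->
  (forall u, inv u -> exists v, step u v) ->
  (forall u v, inv u -> step u v -> inv v) ->
  exists f : nat -> U, computable A f /\ f 0 = u0 /\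
    forall n, inv (f n) /\ step (f n) (f (S n)).
Proof.
  intros HR H0 Hex Hinv. destruct (eval_search A step HR) as [q Hq].
  destruct (choice (fun u v => inv u -> step u v /\ eval A q (enc u) (enc v))) as [nx Hnx].
  { intros u. destruct (classic (inv u)) as [h|h]; [|exists u; tauto].
    destruct (Hq u (Hex u h)) as [v Hv]. eauto. }
  set (f := fun n => nat_rect (fun _ => U) u0 (fun _ u => nx u) n).
  assert (I : forall n, inv (f n)).
  { induction n as [|n IH]; [exact H0|]. eapply Hinv; [exact IH|]. now apply Hnx. }
  exists f. split; [|split; [reflexivity|]].
  - exists (PComp (PRec (cst (enc u0)) (PComp q (PComp PSnd PSnd))) (PPair PZero (PPair PFst PSnd))).
    intros n. eapply ev_comp; [apply ev_pair; [constructor|apply eval_id]|].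
    change (enc n) with n. induction n as [|n IH].
    + apply ev_rec0, eval_cst.
    + eapply ev_recS; [exact IH|]. eapply ev_comp; [|apply (Hnx (f n) (I n))].
      eapply ev_comp; [apply ev_snd|]. rewrite unpair_pair. cbn [snd].
      replace (enc (f n)) with (snd (unpair (pair n (enc (f n))))) at 2; [constructor|].
      now rewrite unpair_pair.
  - intros n. split; auto. now apply Hnx.
Qed.

Lemma decid_range A (f : nat -> nat) :
  computable A f -> (forall n, f n < f (S n)) -> decid A (fun y => exists i, f i = y).
Proof.
  intros Hf Hinc. assert (Hge : forall n, n <= f n).
  { induction n as [|n IH]; [lia|]. specialize (Hinc n). lia. }
  apply decid_ext with (fun y => exists i, i <= y /\ f i = y).
  - intros y. split; [intros [i [_ ?]]; eauto|]. intros [i <-]. exists i. auto.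
  - dcd.
Qed.

(** * Programs *)

(* The scheme generated for [eval] gives no induction hypothesis for the
   evaluations nested under the existential in [ev_mu]. *)
Lemma eval_nested_ind (A : nset) (P : prog -> nat -> nat -> Prop) :
  (forall x, P PZero x 0) -> (forall x, P PSucc x (S x)) ->
  (forall x, P PFst x (fst (unpair x))) -> (forall x, P PSnd x (snd (unpair x))) ->
  (forall x, A x -> P POracle x 1) -> (forall x, ~ A x -> P POracle x 0) ->
  (forall f g x w v, P g x w -> P f w v -> P (PComp f g) x v) ->
  (forall f g x v w, P f x v -> P g x w -> P (PPair f g) x (pair v w)) ->
  (forall f g x v, P f x v -> P (PRec f g) (pair x 0) v) ->
  (forall f g x y w v, P (PRec f g) (pair x y) w -> P g (pair x (pair y w)) v ->
     P (PRec f g) (pair x (S y)) v) ->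
  (forall f x y, P f (pair x y) 0 -> (forall z, z < y -> exists v, P f (pair x z) (S v)) ->
     P (PMu f) x y) ->
  forall p x v, eval A p x v -> P p x v.
Proof.
  intros H1 H2 H3 H4 H5 H6 H7 H8 H9 H10 H11.
  fix IH 4. intros p x v [ | | | |x0 h|x0 h|f g x0 w v0 h h'|f g x0 v0 w h h'|f g x0 v0 h|f g x0 y w v0 h h'|f x0 y h h'].
  - apply H1.
  - apply H2.
  - apply H3.
  - apply H4.
  - now apply H5.
  - now apply H6.
  - apply (H7 f g x0 w v0); apply IH; assumption.
  - apply H8; apply IH; assumption.
  - apply H9; apply IH; assumption.
  - apply (H10 f g x0 y w v0); apply IH; assumption.
  - apply H11; [apply IH; assumption|]. intros z hz. destruct (h' z hz) as [u hu].
    exists u. apply IH. assumption.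
Qed.

Lemma eval_rec_inv A f g z v : eval A (PRec f g) z v ->
  (exists x, z = pair x 0 /\ eval A f x v) \/
  (exists x y w, z = pair x (S y) /\ eval A (PRec f g) (pair x y) w /\
     eval A g (pair x (pair y w)) v).
Proof. intros H. inversion H; subst; eauto 10. Qed.

Lemma eval_det A p x v : eval A p x v -> forall w, eval A p x w -> v = w.
Proof.
  intros H. induction H using eval_nested_ind; intros w' Hw;
    try (inversion Hw; subst; auto; tauto).
  - inversion Hw; subst. match goal with h : eval A g x _ |- _ => apply IHeval in h end. subst. auto.
  - apply eval_rec_inv in Hw as [[x' [E h]]|[x' [y' [w [E _]]]]]; apply pair_inj in E as [-> E]; auto.
    discriminate.
  - apply eval_rec_inv in Hw as [[x' [E h]]|[x' [y' [u [E [h1 h2]]]]]]; apply pair_inj in E as [-> E].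
    + discriminate.
    + injection E as ->. apply IHeval in h1. subst. auto.
  - inversion Hw; subst. destruct (Nat.lt_trichotomy y w') as [h|[h|h]]; auto; exfalso.
    + match goal with h' : forall z, z < w' -> _ |- _ => destruct (h' y h) as [u Hu] end.
      apply IHeval in Hu. discriminate.
    + match goal with h' : forall z, z < y -> _ |- _ => destruct (h' w' h) as [u Hu] end.
      match goal with h' : eval A f (pair x w') 0 |- _ => apply Hu in h' end. discriminate.
Qed.

Lemma code_inj p q : code p = code q -> p = q.
Proof.
  revert q. induction p; intros []; simpl; intros E; apply pair_inj in E as [E1 E2];
    try discriminate; try reflexivity;
    try (apply pair_inj in E2 as [E2 E3]); f_equal; auto.
Qed.

Lemma code_5 p a b : code p = pair 5 (pair a b) -> exists f g, p = PComp f g /\ code f = a /\ code g = b.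
Proof. destruct p; simpl; intros E; apply pair_inj in E as [E1 E]; try discriminate. apply pair_inj in E as []; eauto. Qed.

Lemma code_7 p a b : code p = pair 7 (pair a b) -> exists f g, p = PRec f g /\ code f = a /\ code g = b.
Proof. destruct p; simpl; intros E; apply pair_inj in E as [E1 E]; try discriminate. apply pair_inj in E as []; eauto. Qed.

(** * Oracle substitution, Turing reducibility and joins *)

Fixpoint subst_oracle (q p : prog) : prog :=
  match p with
  | POracle => q
  | PComp f g => PComp (subst_oracle q f) (subst_oracle q g)
  | PPair f g => PPair (subst_oracle q f) (subst_oracle q g)
  | PRec f g => PRec (subst_oracle q f) (subst_oracle q g)
  | PMu f => PMu (subst_oracle q f)
  | _ => p
  end.

Lemma eval_subst_oracle A B q :
  (forall x, eval B q x (chi (A x))) ->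
  forall p x v, eval A p x v -> eval B (subst_oracle q p) x v.
Proof.
  intros Hq p x v H. induction H using eval_nested_ind; simpl; try (econstructor; eauto; fail).
  - rewrite <- (chi_true (A x)) by auto. apply Hq.
  - rewrite <- (chi_false (A x)) by auto. apply Hq.
Qed.

Lemma turing_le_decid B A : turing_le B A <-> decid A (fun x : nat => B x).
Proof.
  split; intros [p Hp]; exists p; intros x.
  - destruct (Hp x) as [v [Hv Hb]]. now rewrite <- (b2n_chi _ _ Hb).
  - exists (chi (B x)). split; [apply Hp | apply chi_spec].
Qed.

Lemma computable_le {T U} `{Enc T} `{Enc U} A B (f : T -> U) :
  turing_le A B -> computable A f -> computable B f.
Proof.
  rewrite turing_le_decid. intros [q Hq] [p Hp]. exists (subst_oracle q p). intros x.
  exact (eval_subst_oracle A B q Hq _ _ _ (Hp x)).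
Qed.

Lemma decid_le_oracle {T} `{Enc T} A B (P : T -> Prop) :
  turing_le A B -> decid A P -> decid B P.
Proof. apply computable_le. Qed.

Lemma turing_le_trans A B C : turing_le A B -> turing_le B C -> turing_le A C.
Proof. rewrite (turing_le_decid A B), (turing_le_decid A C). intros H1 H2. now apply (decid_le_oracle B C). Qed.

Lemma decid_oracle A : decid A (fun x : nat => A x).
Proof. exists POracle. intros x. unfold chi. destruct excluded_middle_informative; now constructor. Qed.

Lemma turing_le_refl A : turing_le A A.
Proof. apply turing_le_decid, decid_oracle. Qed.

Lemma comp_div2 A {T} `{Enc T} (f : T -> nat) : computable A f -> computable A (fun x => Nat.div2 (f x)).
Proof.
  intros Hf. enough (G : computable A Nat.div2) by cpt.
  apply comp_graph. apply decid_ext with (fun t => fst t = 2 * snd t \/ fst t = 2 * snd t + 1); [|dcd].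
  intros [x y]. cbn [fst snd]. pose proof (Nat.div2_odd x). destruct (Nat.odd x); simpl Nat.b2n in *; lia.
Qed.

Lemma decid_even A {T} `{Enc T} (f : T -> nat) : computable A f -> decid A (fun x => Nat.even (f x) = true).
Proof.
  intros Hf. apply decid_ext with (fun x => f x = 2 * Nat.div2 (f x)).
  - intros x. rewrite <- Nat.negb_odd. pose proof (Nat.div2_odd (f x)). destruct (Nat.odd (f x)); simpl in *; intuition (easy || lia).
  - pose proof (comp_div2 A f Hf). dcd.
Qed.

Lemma join_even X Y n : join X Y (2 * n) <-> X n.
Proof. unfold join. now rewrite Nat.even_even, Nat.div2_double. Qed.

Lemma join_odd X Y n : join X Y (2 * n + 1) <-> Y n.
Proof. unfold join. rewrite Nat.even_odd. replace (2 * n + 1) with (S (2 * n)) by lia. now rewrite Nat.div2_succ_double. Qed.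

Lemma join_le_l X Y : turing_le X (join X Y).
Proof.
  apply turing_le_decid. apply decid_ext with (fun n => join X Y (2 * n)); [apply join_even|].
  apply (decid_app _ (fun n => 2 * n) (join X Y) (decid_oracle _)). cpt.
Qed.

Lemma join_le_r X Y : turing_le Y (join X Y).
Proof.
  apply turing_le_decid. apply decid_ext with (fun n => join X Y (2 * n + 1)); [apply join_odd|].
  apply (decid_app _ (fun n => 2 * n + 1) (join X Y) (decid_oracle _)). cpt.
Qed.

Lemma decid_join A {T} `{Enc T} (P : T -> nat -> Prop) (Y : nset) (f : T -> nat) :
  decid A (fun t : T * nat => P (fst t) (snd t)) -> decid A (fun n : nat => Y n) ->
  computable A f -> decid A (fun x => join (P x) Y (f x)).
Proof.
  intros HP HY Hf.
  apply decid_ext with (fun x => (Nat.even (f x) = true /\ P x (Nat.div2 (f x))) \/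
    (~ Nat.even (f x) = true /\ Y (Nat.div2 (f x)))).
  - intros x. unfold join. destruct (Nat.even (f x)); intuition easy.
  - pose proof (comp_div2 A f Hf). pose proof (decid_even A f Hf). dcd.
Qed.

Lemma join_lub X Y A : turing_le X A -> turing_le Y A -> turing_le (join X Y) A.
Proof.
  rewrite !turing_le_decid. intros HX HY.
  apply (decid_join A (fun _ => X) Y (fun x : nat => x)); auto; [dcd|cpt].
Qed.

(** * The normal form theorem *)

Definition halts (A : nset) (c x : nat) : Prop := exists p, code p = c /\ exists v, eval A p x v.

(* [(0, (c, (0, 0)))] claims that [c] codes a program, [(1, (c, (x, v)))]
   claims that the program coded by [c] maps [x] to [v]. *)
Definition claim := (nat * (nat * (nat * nat)))%type.

Notation claim_prog c := (0, (c, (0, 0))).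
Notation claim_eval c x v := (1, (c, (x, v))).

(** One evaluation step, with its premises taken from [E]. An oracle claim is accepted with any
    answer, so that this notion does not mention the oracle; [agrees] checks the answers.
    Intermediate values are read off a member [d] of [E], which keeps every quantifier bounded. The
    base case of recursion does not run the step program, so [claim_prog b] has to vouch for its
    code. *)
Definition justified (e : claim) (E : list claim) : Prop :=
  let c := fst (snd e) in
  let x := fst (snd (snd e)) in
  let v := snd (snd (snd e)) in
  let t := fst (unpair c) in
  let u := snd (unpair c) in
  let a := fst (unpair u) in
  let b := snd (unpair u) in
  let x0 := fst (unpair x) in
  let y := snd (unpair x) in
  (fst e = 0 /\
    ((t <= 4 /\ u = 0) \/
     (5 <= t /\ t <= 7 /\ In (claim_prog a) E /\ In (claim_prog b) E) \/
     (t = 8 /\ In (claim_prog u) E))) \/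
  (fst e = 1 /\
    ((t = 0 /\ u = 0 /\ v = 0) \/
     (t = 1 /\ u = 0 /\ v = S x) \/
     (t = 2 /\ u = 0 /\ v = fst (unpair x)) \/
     (t = 3 /\ u = 0 /\ v = snd (unpair x)) \/
     (t = 4 /\ u = 0) \/
     (t = 5 /\ exists d, In d E /\ (d = claim_eval b x (snd (snd (snd d))) /\
        In (claim_eval a (snd (snd (snd d))) v) E)) \/
     (t = 6 /\ In (claim_eval a x (fst (unpair v))) E /\ In (claim_eval b x (snd (unpair v))) E) \/
     (t = 7 /\ y = 0 /\ In (claim_eval a x0 v) E /\ In (claim_prog b) E) \/
     (t = 7 /\ ~ y = 0 /\ exists d, In d E /\ (d = claim_eval c (pair x0 (pred y)) (snd (snd (snd d))) /\
        In (claim_eval b (pair x0 (pair (pred y) (snd (snd (snd d))))) v) E)) \/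
     (t = 8 /\ In (claim_eval u (pair x v) 0) E /\
        forall z, z < v -> exists d, In d E /\
          (d = claim_eval u (pair x z) (snd (snd (snd d))) /\ ~ snd (snd (snd d)) = 0)))).

Definition agrees (A : nset) (E : list claim) : Prop :=
  forall e, In e E -> fst e = 1 -> fst (snd e) = code POracle ->
    snd (snd (snd e)) = chi (A (fst (snd (snd e)))).

Lemma justified_mono e E E' : incl E E' -> justified e E -> justified e E'.
Proof.
  intros I. unfold justified. intros [[? h]|[? h]]; [left|right]; split; auto.
  - destruct h as [h|[h|h]]; [left|right; left|right; right]; intuition.
  - destruct h as [h|[h|[h|[h|[h|[[h [d [h1 [h2 h3]]]]|[h|[h|[[h [h0 [d [h1 [h2 h3]]]]]|[h [h0 h1]]]]]]]]]]].
    + tauto.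
    + tauto.
    + tauto.
    + tauto.
    + tauto.
    + do 5 right; left. split; auto. exists d. auto.
    + do 6 right; left. intuition.
    + do 7 right; left. intuition.
    + do 8 right; left. split; auto. split; auto. exists d. auto.
    + do 9 right. split; auto. split; auto. intros z hz. destruct (h1 z hz) as [d [? ?]]. exists d. auto.
Qed.

Lemma certificate_app E E' :
  all_suffixes justified E -> all_suffixes justified E' -> all_suffixes justified (E ++ E').
Proof.
  intros H H'. induction E as [|e E IH]; simpl in *; auto. split; [|tauto].
  eapply justified_mono; [|apply H]. now apply incl_appl.
Qed.

Lemma agrees_app A E E' : agrees A E -> agrees A E' -> agrees A (E ++ E').
Proof. intros H H' e Hi. apply in_app_or in Hi as [Hi|Hi]; auto. Qed.

Lemma agrees_cons A e E :
  (fst e = 1 -> fst (snd e) = code POracle -> snd (snd (snd e)) = chi (A (fst (snd (snd e))))) ->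
  agrees A E -> agrees A (e :: E).
Proof. intros H H' d [<-|Hi]; auto. Qed.

Definition certified (A : nset) (e : claim) : Prop :=
  exists E, all_suffixes justified E /\ agrees A E /\ In e E.

Lemma certified_list A (l : list claim) :
  (forall e, In e l -> certified A e) ->
  exists E, all_suffixes justified E /\ agrees A E /\ incl l E.
Proof.
  induction l as [|e l IH]; intros H.
  - exists []. split; [exact I|]. split; intros e [].
  - destruct IH as [E [h1 [h2 h3]]]; [intros; apply H; now right|].
    destruct (H e) as [E' [h1' [h2' h3']]]; [now left|].
    exists (E' ++ E). split; [|split].
    + now apply certificate_app.
    + now apply agrees_app.
    + intros d [<-|Hd]; apply in_or_app; auto.
Qed.

(** Justification survives enlarging the list, so the certificates of the premises can be
    concatenated and [e] put in front. *)
Lemma certified_intro A e (l : list claim) :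
  (forall d, In d l -> certified A d) ->
  (fst e = 1 -> fst (snd e) = code POracle -> snd (snd (snd e)) = chi (A (fst (snd (snd e))))) ->
  (forall E, incl l E -> justified e E) -> certified A e.
Proof.
  intros Hl Ho HJ. destruct (certified_list A l Hl) as [E [h1 [h2 h3]]].
  exists (e :: E). split; [|split].
  - simpl. auto.
  - now apply agrees_cons.
  - now left.
Qed.

Lemma certified_prog A p : certified A (claim_prog (code p)).
Proof.
  induction p as [| | | | |p1 IH1 p2 IH2|p1 IH1 p2 IH2|p1 IH1 p2 IH2|p IH];
  [ apply (certified_intro A _ []) | apply (certified_intro A _ []) | apply (certified_intro A _ [])
  | apply (certified_intro A _ []) | apply (certified_intro A _ [])
  | apply (certified_intro A _ [claim_prog (code p1); claim_prog (code p2)])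
  | apply (certified_intro A _ [claim_prog (code p1); claim_prog (code p2)])
  | apply (certified_intro A _ [claim_prog (code p1); claim_prog (code p2)])
  | apply (certified_intro A _ [claim_prog (code p)]) ]; try easy;
  try (intros d [<-|[<-|[]]]; assumption); try (intros d [<-|[]]; assumption);
  intros E HE; left; cbn [code fst snd]; rewrite ?unpair_pair; cbn [fst snd]; rewrite ?unpair_pair; cbn [fst snd];
  split; auto; try (left; split; [lia|reflexivity]).
  - right; left. repeat split; try lia; apply HE; simpl; auto.
  - right; left. repeat split; try lia; apply HE; simpl; auto.
  - right; left. repeat split; try lia; apply HE; simpl; auto.
  - right; right. split; auto. apply HE. simpl. auto.
Qed.

Ltac jst := intros E HE; right; cbn [code fst snd]; rewrite ?unpair_pair; cbn [fst snd];
  rewrite ?unpair_pair; cbn [fst snd]; split; [reflexivity|].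

Lemma code_not_oracle t u : t <> 4 -> pair t u <> code POracle.
Proof. simpl. intros h E. apply pair_inj in E as [? _]. auto. Qed.

Lemma certified_eval A p x v : eval A p x v -> certified A (claim_eval (code p) x v).
Proof.
  intros H. induction H using eval_nested_ind.
  - apply (certified_intro A _ []); [easy| |].
    + intros _ E. exfalso. revert E. now apply code_not_oracle.
    + jst. left. auto.
  - apply (certified_intro A _ []); [easy| |].
    + intros _ E. exfalso. revert E. now apply code_not_oracle.
    + jst. right; left. auto.
  - apply (certified_intro A _ []); [easy| |].
    + intros _ E. exfalso. revert E. now apply code_not_oracle.
    + jst. do 2 right; left. repeat split.
  - apply (certified_intro A _ []); [easy| |].
    + intros _ E. exfalso. revert E. now apply code_not_oracle.
    + jst. do 3 right; left. repeat split.
  - apply (certified_intro A _ []); [easy| |].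
    + intros _ _. cbn. now rewrite chi_true.
    + jst. do 4 right; left. auto.
  - apply (certified_intro A _ []); [easy| |].
    + intros _ _. cbn. now rewrite chi_false.
    + jst. do 4 right; left. auto.
  - apply (certified_intro A _ [claim_eval (code g) x w; claim_eval (code f) w v]).
    + intros d [<-|[<-|[]]]; assumption.
    + intros _ E. exfalso. revert E. now apply code_not_oracle.
    + jst. do 5 right; left. split; auto. exists (claim_eval (code g) x w). cbn [fst snd].
      repeat split; apply HE; simpl; auto.
  - apply (certified_intro A _ [claim_eval (code f) x v; claim_eval (code g) x w]).
    + intros d [<-|[<-|[]]]; assumption.
    + intros _ E. exfalso. revert E. now apply code_not_oracle.
    + jst. do 6 right; left. repeat split; apply HE; simpl; auto.
  - apply (certified_intro A _ [claim_eval (code f) x v; claim_prog (code g)]).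
    + intros d [<-|[<-|[]]]; [assumption|apply certified_prog].
    + intros _ E. exfalso. revert E. now apply code_not_oracle.
    + jst. do 7 right; left. repeat split; apply HE; simpl; auto.
  - apply (certified_intro A _ [claim_eval (code (PRec f g)) (pair x y) w; claim_eval (code g) (pair x (pair y w)) v]).
    + intros d [<-|[<-|[]]]; assumption.
    + intros _ E. exfalso. revert E. now apply code_not_oracle.
    + jst. do 8 right; left. split; auto. split; [lia|].
      exists (claim_eval (code (PRec f g)) (pair x y) w). cbn [fst snd pred].
      repeat split; apply HE; simpl; auto.
  - destruct (choice (fun z v => z < y -> certified A (claim_eval (code f) (pair x z) (S v)))) as [h Hh].
    { intros z. destruct (Nat.lt_ge_cases z y) as [hz|hz]; [|exists 0; lia].
      destruct (H z hz) as [v Hv]. eauto. }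
    apply (certified_intro A _ (claim_eval (code f) (pair x y) 0 ::
      map (fun z => claim_eval (code f) (pair x z) (S (h z))) (seq 0 y))).
    + intros d [<-|Hd]; auto. apply in_map_iff in Hd as [z [<- Hz]]. apply Hh. apply in_seq in Hz. lia.
    + intros _ E. exfalso. revert E. now apply code_not_oracle.
    + jst. do 9 right. split; auto. split; [apply HE; simpl; auto|].
      intros z hz. exists (claim_eval (code f) (pair x z) (S (h z))). cbn [fst snd].
      split; [|auto]. apply HE. right. apply in_map_iff. exists z. split; auto. apply in_seq. lia.
Qed.

Definition claim_true (A : nset) (e : claim) : Prop :=
  exists p, code p = fst (snd e) /\ (fst e = 1 -> eval A p (fst (snd (snd e))) (snd (snd (snd e)))).

Lemma justified_true A e E :
  (fst e = 1 -> fst (snd e) = code POracle -> snd (snd (snd e)) = chi (A (fst (snd (snd e))))) ->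
  (forall d, In d E -> claim_true A d) -> justified e E -> claim_true A e.
Proof.
  destruct e as [k [c [x v]]]. unfold justified. cbn [fst snd]. intros HO HE.
  assert (HP : forall a, In (claim_prog a) E -> exists p, code p = a).
  { intros a Ha. destruct (HE _ Ha) as [p [? _]]. eauto. }
  assert (HV : forall a x v, In (claim_eval a x v) E -> exists p, code p = a /\ eval A p x v).
  { intros a x' v' Ha. destruct (HE _ Ha) as [p [? h]]. exists p. split; [assumption|now apply h]. }
  rewrite <- (pair_unpair c) in *. destruct (unpair c) as [t u]. cbn [fst snd] in *.
  rewrite !unpair_pair. cbn [fst snd].
  intros [[Hk h]|[Hk h]]; subst k.
  - destruct h as [[h1 h2]|[[h1 [h2 [h3 h4]]]|[h1 h2]]].
    + subst u. assert (exists p, code p = pair t 0) as [p Hp].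
      { destruct t as [|[|[|[|[|t]]]]]; [exists PZero|exists PSucc|exists PFst|exists PSnd|exists POracle|lia]; reflexivity. }
      exists p. split; [exact Hp|easy].
    + apply HP in h3 as [p Hp]. apply HP in h4 as [q Hq].
      assert (exists r, code r = pair t u) as [r Hr].
      { rewrite <- (pair_unpair u), <- Hp, <- Hq.
        destruct (Nat.eq_dec t 5) as [->|]; [exists (PComp p q); reflexivity|].
        destruct (Nat.eq_dec t 6) as [->|]; [exists (PPair p q); reflexivity|].
        replace t with 7 by lia. exists (PRec p q). reflexivity. }
      exists r. split; [exact Hr|easy].
    + apply HP in h2 as [p Hp]. exists (PMu p). split; [|easy]. simpl. now rewrite Hp, h1.
  - unfold claim_true. cbn [fst snd].
    destruct h as [h|[h|[h|[h|[h|[[h [d [h1 [h2 h3]]]]|[h|[h|[[h [h0 [d [h1 [h2 h3]]]]]|[h [h0 h1]]]]]]]]]]].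
    + destruct h as [-> [-> ->]]. exists PZero. split; [reflexivity|constructor].
    + destruct h as [-> [-> ->]]. exists PSucc. split; [reflexivity|constructor].
    + destruct h as [-> [-> ->]]. exists PFst. split; [reflexivity|constructor].
    + destruct h as [-> [-> ->]]. exists PSnd. split; [reflexivity|constructor].
    + destruct h as [-> ->]. exists POracle. split; [reflexivity|]. intros _.
      rewrite HO by reflexivity. unfold chi. destruct excluded_middle_informative; now constructor.
    + subst t. rewrite h2 in h1. apply HV in h1 as [q [Hq Eq]]. apply HV in h3 as [p [Hp Ep]].
      exists (PComp p q). split; [|econstructor; eauto]. simpl. now rewrite Hp, Hq, pair_unpair.
    + destruct h as [-> [h1 h2]]. apply HV in h1 as [p [Hp Ep]]. apply HV in h2 as [q [Hq Eq]].
      exists (PPair p q). split; [simpl; now rewrite Hp, Hq, pair_unpair|].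
      intros _. rewrite <- (pair_unpair v). now constructor.
    + destruct h as [-> [h0 [h1 h2]]]. apply HV in h1 as [p [Hp Ep]]. apply HP in h2 as [q Hq].
      exists (PRec p q). split; [simpl; now rewrite Hp, Hq, pair_unpair|].
      intros _. rewrite <- (pair_unpair x), h0. now constructor.
    + subst t. rewrite h2 in h1. apply HV in h1 as [r [Hr Er]]. apply HV in h3 as [q [Hq Eq]].
      rewrite <- (pair_unpair u) in Hr. destruct (code_7 _ _ _ Hr) as [f [g [-> [Hf Hg]]]].
      exists (PRec f g). split; [now rewrite <- (pair_unpair u)|]. intros _.
      rewrite <- (pair_unpair x). destruct (snd (unpair x)) as [|y]; [easy|].
      assert (q = g) by (apply code_inj; congruence). subst q. econstructor; eauto.
    + subst t. apply HV in h0 as [p [Hp Ep]]. exists (PMu p). split; [simpl; now rewrite Hp|].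
      intros _. constructor; auto. intros z hz. destruct (h1 z hz) as [d [k1 [k2 k3]]].
      rewrite k2 in k1. apply HV in k1 as [q [Hq Eq]].
      assert (q = p) by (apply code_inj; congruence). subst q.
      destruct (snd (snd (snd d))) as [|w]; [easy|]. eauto.
Qed.

Lemma certificate_true A E :
  all_suffixes justified E -> agrees A E -> forall e, In e E -> claim_true A e.
Proof.
  induction E as [|e E IH]; [easy|]. intros [HJ HE] HA.
  assert (IH' : forall d, In d E -> claim_true A d).
  { apply IH; auto. intros d Hd. apply HA. now right. }
  intros d [<-|Hd]; auto. apply (justified_true A e E); auto. apply HA. now left.
Qed.

Lemma halts_certificate A c x :
  halts A c x <-> exists E, all_suffixes justified E /\ agrees A E /\
    exists e, In e E /\ e = claim_eval c x (snd (snd (snd e))).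
Proof.
  split.
  - intros [p [<- [v Hv]]]. apply certified_eval in Hv as [E [h1 [h2 h3]]].
    exists E. split; auto. split; auto. eexists. split; [exact h3|reflexivity].
  - intros [E [h1 [h2 [e [h3 h4]]]]]. destruct (certificate_true A E h1 h2 e h3) as [p [Hp Ep]].
    rewrite h4 in Hp, Ep. exists p. split; [exact Hp|]. eexists. now apply Ep.
Qed.

Lemma decid_justified A : decid A (fun t : claim * list claim => justified (fst t) (snd t)).
Proof. unfold justified. dcd. Qed.

(** The number [k] bounds time and use together: a query in a certificate is smaller than the code
    of the certificate, so the first [k] bits of the oracle settle the matter. *)
Definition halts_in (A : nset) (c x k : nat) : Prop :=
  exists i, i < k /\ (all_suffixes justified (dec i) /\ agrees A (dec i) /\
    exists e, In e (dec i) /\ e = claim_eval c x (snd (snd (snd e)))).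

Lemma halts_iff A c x : halts A c x <-> exists k, halts_in A c x k.
Proof.
  rewrite halts_certificate. split.
  - intros [E h]. exists (S (enc E)), (enc E). split; [lia|]. now rewrite !dec_enc.
  - intros [k [i [_ h]]]. eauto.
Qed.

Lemma halts_in_mono A c x k k' : k <= k' -> halts_in A c x k -> halts_in A c x k'.
Proof. intros H [i [hi h]]. exists i. split; [lia|auto]. Qed.

Definition eq_below (k : nat) (X Y : nset) : Prop := forall i, i < k -> (X i <-> Y i).

Lemma eq_below_le k k' X Y : k <= k' -> eq_below k' X Y -> eq_below k X Y.
Proof. intros H h i hi. apply h. lia. Qed.

Lemma eq_below_sym k X Y : eq_below k X Y -> eq_below k Y X.
Proof. intros h i hi. symmetry. auto. Qed.

Lemma eq_below_trans k X Y Z : eq_below k X Y -> eq_below k Y Z -> eq_below k X Z.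
Proof. intros h h' i hi. transitivity (Y i); auto. Qed.

Lemma eq_below_join k X Y B : eq_below k X Y -> eq_below k (join X B) (join Y B).
Proof.
  intros H i hi. unfold join. destruct (Nat.even i); [|tauto].
  apply H. pose proof (Nat.div2_decr i i). lia.
Qed.

Lemma halts_in_use A A' c x k : eq_below k A A' -> halts_in A c x k -> halts_in A' c x k.
Proof.
  intros HA [i [hi [h1 [h2 h3]]]]. exists i. split; auto. split; auto. split; auto.
  intros e He k1 k2. rewrite (h2 e He k1 k2). apply chi_iff, HA.
  apply In_enc_lt in He. rewrite enc_dec in He. destruct e as [a [b [d v]]].
  cbn [fst snd]. simpl enc in He.
  pose proof (pair_le_r a (pair b (pair d v))). pose proof (pair_le_r b (pair d v)).
  pose proof (pair_le_l d v). lia.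
Qed.

Lemma decid_halts_in A {T} `{Enc T} (P : T -> nat -> Prop) (c x k : T -> nat) :
  decid A (fun t : T * nat => P (fst t) (snd t)) ->
  computable A c -> computable A x -> computable A k ->
  decid A (fun t => halts_in (P t) (c t) (x t) (k t)).
Proof. intros HP Hc Hx Hk. pose proof (decid_justified A). unfold halts_in, agrees. dcd. Qed.

(** * Semidecidable predicates and the jump *)

Definition semi (A : nset) {T} `{Enc T} (P : T -> Prop) : Prop :=
  exists R : T -> nat -> Prop,
    decid A (fun t : T * nat => R (fst t) (snd t)) /\ forall x, P x <-> exists n, R x n.

Lemma semi_decid A {T} `{Enc T} (P : T -> Prop) : decid A P -> semi A P.
Proof. intros HP. exists (fun x _ => P x). split; [dcd|]. intros x. split; [now exists 0|now intros [_ ?]]. Qed.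

Lemma semi_ex A {T U} `{Enc T} `{Enc U} (P : T -> U -> Prop) :
  semi A (fun t : T * U => P (fst t) (snd t)) -> semi A (fun x => exists u, P x u).
Proof.
  intros [R [HR h]]. exists (fun x n => R (x, dec (fst (unpair n))) (snd (unpair n))). split; [dcd|].
  intros x. split.
  - intros [u hu]. destruct (proj1 (h (x, u)) hu) as [n hn]. exists (pair (enc u) n).
    rewrite unpair_pair. cbn [fst snd]. now rewrite dec_enc.
  - intros [n hn]. exists (dec (fst (unpair n))). apply (h (x, dec (fst (unpair n)))). eauto.
Qed.

Lemma semi_oracle_le A B {T} `{Enc T} (P : T -> Prop) : turing_le A B -> semi A P -> semi B P.
Proof. intros HAB [R [HR h]]. exists R. split; auto. now apply (decid_le_oracle A B). Qed.

Lemma semi_halts A {T} `{Enc T} (c x : T -> nat) :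
  computable A c -> computable A x -> semi A (fun t => halts A (c t) (x t)).
Proof.
  intros Hc Hx. exists (fun t k => halts_in A (c t) (x t) k). split; [|intros; apply halts_iff].
  pose proof (decid_oracle A).
  apply (decid_halts_in A (fun _ => A) (fun t : T * nat => c (fst t)) (fun t => x (fst t)) snd); try cpt. dcd.
Qed.

Lemma semi_code A {T} `{Enc T} (P : T -> Prop) :
  semi A P -> exists p, forall x, P x <-> exists v, eval A p (enc x) v.
Proof.
  intros [R [HR h]].
  assert (HC : computable A (fun t : T * nat => 1 - chi (R (fst t) (snd t)))) by cpt.
  destruct HC as [p Hp]. exists (PMu p). intros x. rewrite h. split.
  - intros Hex. destruct (least_exists _ Hex) as [n [Hn Hmin]]. exists n. apply ev_mu.
    + specialize (Hp (x, n)). cbn [fst snd] in Hp. now rewrite chi_true in Hp.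
    + intros z hz. exists 0. specialize (Hp (x, z)). cbn [fst snd] in Hp.
      now rewrite chi_false in Hp by auto.
  - intros [v Hv]. inversion Hv; subst. exists v. specialize (Hp (x, v)). cbn [fst snd] in Hp.
    apply NNPP. intros hR. rewrite chi_false in Hp by auto.
    match goal with k : eval A p (pair (enc x) v) 0 |- _ => pose proof (eval_det _ _ _ _ Hp _ k) as E end.
    discriminate.
Qed.

Lemma comp_code_cst A : computable A (fun n => code (cst n)).
Proof.
  apply comp_ext with (fun n => nat_rect (fun _ => nat) (code PZero)
    (fun _ r => pair 5 (pair (code PSucc) r)) n).
  - induction x as [|n IH]; [reflexivity|]. simpl in *. now rewrite IH.
  - apply (comp_rec A (fun _ => code PZero) (fun _ _ r => pair 5 (pair (code PSucc) r)) (fun n => n)); cpt.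
Qed.

(** The jump runs a program on its own code. [PComp p (cst (enc x))] ignores its input, so there it
    behaves like [p] on [x], and its code is computable from [x]. *)
Lemma decid_jump A {T} `{Enc T} (P : T -> Prop) : semi A P -> decid (jump A) P.
Proof.
  intros HP. destruct (semi_code A P HP) as [p Hp].
  apply decid_ext with (fun x => jump A (pair 5 (pair (code p) (code (cst (enc x)))))).
  - intros x. rewrite Hp. split.
    + intros [q [Hq [v Hv]]]. destruct (code_5 _ _ _ Hq) as [f [g [-> [Hf Hg]]]].
      apply code_inj in Hf, Hg. subst f g. inversion Hv; subst.
      match goal with h : eval A (cst _) _ ?w |- _ =>
        rewrite (eval_det _ _ _ _ h _ (eval_cst A (enc x) _)) in * end. eauto.
    + intros [v Hv]. exists (PComp p (cst (enc x))). split; [reflexivity|]. exists v.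
      eapply ev_comp; [apply eval_cst|exact Hv].
  - pose proof (decid_oracle (jump A)). 
    assert (computable (jump A) (fun x : T => code (cst (enc x)))).
    { apply (comp_app _ (fun x : T => enc x) (fun n => code (cst n))); [apply comp_code_cst|cpt]. }
    dcd.
Qed.

Lemma semi_jump A : semi A (fun e : nat => jump A e).
Proof. apply (semi_halts A (fun e => e) (fun e => e)); cpt. Qed.

Lemma le_jump A : turing_le A (jump A).
Proof. apply turing_le_decid, decid_jump, semi_decid, decid_oracle. Qed.

Lemma jump_mono A B : turing_le A B -> turing_le (jump A) (jump B).
Proof. intros H. apply turing_le_decid, decid_jump, (semi_oracle_le A B _ H), semi_jump. Qed.

(** * Binary prefixes *)

Definition bits (m : nat) : nset := fun i => Nat.testbit m i = true.

(** The bounded quantifiers make the bits decidable through the closure lemmas. *)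
Lemma bits_iff m i : bits m i <-> exists q, q <= m /\ exists r, r < 2 ^ i /\ m = (2 * q + 1) * 2 ^ i + r.
Proof.
  unfold bits. rewrite Nat.testbit_true.
  assert (2 ^ i <> 0) by (apply Nat.pow_nonzero; lia). split.
  - intros E. exists (m / 2 ^ i / 2). split; [|exists (m mod 2 ^ i); split].
    + etransitivity; [apply Nat.Div0.div_le_upper_bound with (q := m / 2 ^ i); lia|].
      apply Nat.Div0.div_le_upper_bound. nia.
    + now apply Nat.mod_upper_bound.
    + pose proof (Nat.div_mod (m / 2 ^ i) 2). pose proof (Nat.div_mod m (2 ^ i)). nia.
  - intros [q [_ [r [Hr ->]]]].
    rewrite Nat.add_comm, Nat.div_add, Nat.div_small by auto.
    rewrite Nat.add_0_l, Nat.add_comm, Nat.mul_comm. now rewrite Nat.Div0.mod_add.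
Qed.

Lemma decid_bits A {T} `{Enc T} (m i : T -> nat) :
  computable A m -> computable A i -> decid A (fun x => bits (m x) (i x)).
Proof.
  intros Hm Hi. eapply decid_ext; [intros; symmetry; apply bits_iff|]. dcd.
Qed.

Lemma decid_eq_below_bits A {T} `{Enc T} (k m m' : T -> nat) :
  computable A k -> computable A m -> computable A m' ->
  decid A (fun x => eq_below (k x) (bits (m x)) (bits (m' x))).
Proof.
  intros Hk Hm Hm'. unfold eq_below.
  apply (decid_ball A (fun x i => bits (m x) i <-> bits (m' x) i) k); auto.
  apply (decid_iff A (fun t : T * nat => bits (m (fst t)) (snd t)) (fun t => bits (m' (fst t)) (snd t)));
    apply decid_bits; cpt.
Qed.

Lemma bits_top k m i : m < 2 ^ k -> k <= i -> ~ bits m i.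
Proof.
  intros Hm Hi. unfold bits. rewrite Nat.testbit_true, Nat.div_small; [easy|].
  eapply Nat.lt_le_trans; [exact Hm|]. apply Nat.pow_le_mono_r; lia.
Qed.

Lemma bits_add_pow k m i : m < 2 ^ k -> (bits (m + 2 ^ k) i <-> i = k \/ bits m i).
Proof.
  intros Hm. destruct (Nat.lt_trichotomy i k) as [h|[->|h]].
  - unfold bits. rewrite <- (Nat.mod_pow2_bits_low (m + 2 ^ k) k i) by auto.
    rewrite <- (Nat.mul_1_l (2 ^ k)) at 1. rewrite Nat.Div0.mod_add, Nat.mod_small by auto.
    intuition lia.
  - split; auto. intros _. apply bits_iff. exists 0. split; [lia|]. exists m. lia.
  - split.
    + intros hb. exfalso. revert hb. apply (bits_top (S k)); [simpl; lia|lia].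
    + intros [->|hb]; [lia|]. exfalso. revert hb. apply (bits_top k); lia.
Qed.

Lemma prefix_exists (Y : nset) k : exists m, m < 2 ^ k /\ eq_below k (bits m) Y.
Proof.
  induction k as [|k [m [Hm IH]]]; [exists 0; simpl; split; [lia|intros i hi; lia]|].
  destruct (classic (Y k)) as [h|h].
  - exists (m + 2 ^ k). split; [simpl; lia|]. intros i hi. rewrite bits_add_pow by auto.
    destruct (Nat.eq_dec i k) as [->|hne]; [tauto|]. specialize (IH i ltac:(lia)). tauto.
  - exists m. split; [simpl; lia|]. intros i hi. destruct (Nat.eq_dec i k) as [->|hne]; [|apply IH; lia].
    split; [|tauto]. intros hb. exfalso. revert hb. apply (bits_top k); lia.
Qed.

Lemma prefix_unique k m m' : m < 2 ^ k -> m' < 2 ^ k -> eq_below k (bits m) (bits m') -> m = m'.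
Proof.
  intros Hm Hm' H. apply Nat.bits_inj. intros i.
  destruct (Nat.lt_ge_cases i k) as [h|h].
  - specialize (H i h). unfold bits in H. destruct (Nat.testbit m i), (Nat.testbit m' i); intuition easy.
  - pose proof (bits_top k m i Hm h) as h1. pose proof (bits_top k m' i Hm' h) as h2. unfold bits in *.
    destruct (Nat.testbit m i), (Nat.testbit m' i); intuition easy.
Qed.

Lemma bits_mod k m : eq_below k (bits (m mod 2 ^ k)) (bits m).
Proof. intros i hi. unfold bits. now rewrite Nat.mod_pow2_bits_low. Qed.

Lemma comp_prefix A X : decid A (fun i : nat => X i) ->
  exists f : nat -> nat, computable A f /\ forall k, f k < 2 ^ k /\ eq_below k (bits (f k)) X.
Proof.
  intros HX. apply (comp_select A (fun k m => m < 2 ^ k /\ eq_below k (bits m) X)).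
  - unfold eq_below.
    assert (decid A (fun t : (nat * nat) * nat => bits (snd (fst t)) (snd t))) by (apply decid_bits; cpt).
    dcd.
  - intros k. apply prefix_exists.
Qed.

(** * Compactness *)

Lemma bounded_choice (P : nat -> nat -> Prop) N :
  (forall k b b', b <= b' -> P k b -> P k b') ->
  (forall k, k < N -> exists b, P k b) -> exists b, forall k, k < N -> P k b.
Proof.
  intros Hm. induction N as [|N IH]; intros H; [exists 0; lia|].
  destruct IH as [b Hb]; [intros; apply H; lia|]. destruct (H N) as [b' Hb']; [lia|].
  exists (max b b'). intros k hk. destruct (Nat.eq_dec k N) as [->|].
  - apply (Hm N b'); auto. lia.
  - apply (Hm k b); [lia|]. apply Hb. lia.
Qed.

Section Fan.
Context (O : nat -> nat -> Prop).

Let caught (N : nat) (Y : nset) : Prop :=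
  exists k m, k < N /\ m < N /\ eq_below k (bits m) Y /\ O k m.

Let covered (n : nat) (Z : nset) : Prop := exists N, forall Y, eq_below n Y Z -> caught N Y.

Let extend (n : nat) (Z : nset) : nset := fun i => i = n \/ (i < n /\ Z i).
Let restrict (n : nat) (Z : nset) : nset := fun i => i < n /\ Z i.

Lemma covered_ext n Z Z' : eq_below n Z Z' -> covered n Z -> covered n Z'.
Proof.
  intros H [N HN]. exists N. intros Y HY. apply HN. eapply eq_below_trans; [exact HY|].
  now apply eq_below_sym.
Qed.

Lemma covered_split n Z :
  covered (S n) (extend n Z) -> covered (S n) (restrict n Z) -> covered n Z.
Proof.
  intros [N HN] [N' HN']. exists (max N N'). intros Y HY.
  assert (caught N Y \/ caught N' Y) as [h|h].
  { destruct (classic (Y n)) as [h|h]; [left; apply HN|right; apply HN'];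
      intros i hi; unfold extend, restrict; destruct (Nat.eq_dec i n) as [->|hne];
      try (split; intuition lia); specialize (HY i ltac:(lia)); intuition lia. }
  - destruct h as [k [m [? [? ?]]]]. exists k, m. intuition lia.
  - destruct h as [k [m [? [? ?]]]]. exists k, m. intuition lia.
Qed.

(** The prefix of length [n] of a path whose cylinders all lack a finite subcover; bit [n] is set
    whenever this is possible with the bit set. *)
Fixpoint escape (n : nat) : nset :=
  match n with
  | 0 => fun _ => False
  | S n => fun i => (i = n /\ ~ covered (S n) (extend n (escape n))) \/ (i < n /\ escape n i)
  end.

Lemma fan :
  (forall Y, exists k m, eq_below k (bits m) Y /\ O k m) ->
  exists N, forall Y, exists k m, k < N /\ m < N /\ eq_below k (bits m) Y /\ O k m.
Proof.
  intros H. enough (covered 0 (escape 0)) as [N HN].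
  { exists N. intros Y. apply HN. intros i hi. lia. }
  apply NNPP. intros H0.
  assert (Hn : forall n, ~ covered n (escape n)).
  { induction n as [|n IH]; auto. intros h. apply IH.
    destruct (classic (covered (S n) (extend n (escape n)))) as [h'|h'].
    - apply covered_split; auto. eapply covered_ext; [|exact h].
      intros i hi. simpl. unfold restrict. intuition.
    - exfalso. apply h'. eapply covered_ext; [|exact h].
      intros i hi. simpl. unfold extend. intuition. }
  (* The path itself is the diagonal: bit [i] is final from stage [S i] on. *)
  assert (He : forall n, eq_below n (fun i => escape (S i) i) (escape n)).
  { induction n as [|n IH]; intros i hi; [lia|].
    destruct (Nat.eq_dec i n) as [->|hne]; [tauto|]. specialize (IH i ltac:(lia)). simpl in *. intuition lia. }
  destruct (H (fun i => escape (S i) i)) as [k [m [h1 h2]]].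
  apply (Hn k). exists (S (max k m)). intros Y HY. exists k, m.
  split; [lia|]. split; [lia|]. split; auto.
  eapply eq_below_trans; [exact h1|]. eapply eq_below_trans; [apply He|]. now apply eq_below_sym.
Qed.
End Fan.

(** Finitely many cylinders suffice to cover, and each lies in some [V n], so the largest index
    involved covers everything. In complements: decreasing nonempty closed sets have a common
    point. *)
Lemma fan_increasing (O : nat -> nat -> nat -> Prop) :
  let V n Y := exists k m, eq_below k (bits m) Y /\ O n k m in
  (forall n n' Y, n <= n' -> V n Y -> V n' Y) ->
  (forall Y, exists n, V n Y) -> exists n, forall Y, V n Y.
Proof.
  intros V Hm H.
  destruct (fan (fun k m => exists n, O n k m)) as [N HN].
  { intros Y. destruct (H Y) as [n [k [m [? ?]]]]. eauto. }
  destruct (bounded_choice (fun k b => forall Y m, m < N -> eq_below k (bits m) Y ->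
     (exists n, O n k m) -> V b Y) N) as [b Hb].
  - intros k b b' hb h Y m hm hY ho. eapply Hm; eauto.
  - intros k hk.
    destruct (bounded_choice (fun m b => forall Y, eq_below k (bits m) Y ->
      (exists n, O n k m) -> V b Y) N) as [b Hb].
    + intros m b b' hb h Y hY ho. eapply Hm; eauto.
    + intros m hm. destruct (classic (exists n, O n k m)) as [[n h]|h].
      * exists n. intros Y hY _. exists k, m. auto.
      * exists 0. tauto.
    + exists b. intros Y m hm. now apply Hb.
  - exists b. intros Y. destruct (HN Y) as [k [m [h1 [h2 [h3 h4]]]]]. apply (Hb k h1 Y m); auto.
Qed.

(** * The low basis theorem *)

(* [V x] is an open subset of Cantor space, effectively in [B] and uniformly in
   [x]: [R x k m] enumerates the cylinder of the [k] lowest bits of [m]. *)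
Definition sigma_class (B : nset) {T} `{Enc T} (V : T -> nset -> Prop) : Prop :=
  exists R : T -> nat -> nat -> Prop,
    decid B (fun t : T * (nat * nat) => R (fst t) (fst (snd t)) (snd (snd t))) /\
    forall x Y, V x Y <-> exists k m, eq_below k (bits m) Y /\ R x k m.

Lemma sigma_class_halts B {T} `{Enc T} (c x : T -> nat) :
  computable B c -> computable B x ->
  sigma_class B (fun t Y => halts (join Y B) (c t) (x t)).
Proof.
  intros Hc Hx. exists (fun t k m => halts_in (join (bits m) B) (c t) (x t) k). split.
  - apply (decid_halts_in B (fun t : T * (nat * nat) => join (bits (snd (snd t))) B)
      (fun t => c (fst t)) (fun t => x (fst t)) (fun t => fst (snd t))); try cpt.
    apply (decid_join B (fun t : (T * (nat * nat)) * nat => bits (snd (snd (fst t)))) B (fun t => snd t));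
      [apply decid_bits; cpt|apply decid_oracle|cpt].
  - intros t Y. rewrite halts_iff. split.
    + intros [k hk]. destruct (prefix_exists Y k) as [m [_ hm]]. exists k, m. split; auto.
      eapply halts_in_use; [|exact hk]. apply eq_below_join. now apply eq_below_sym.
    + intros [k [m [hm hk]]]. exists k. eapply halts_in_use; [|exact hk]. now apply eq_below_join.
Qed.

Lemma sigma_class_or B {T} `{Enc T} (V W : T -> nset -> Prop) :
  sigma_class B V -> sigma_class B W -> sigma_class B (fun x Y => V x Y \/ W x Y).
Proof.
  intros [R [HR h]] [S [HS h']]. exists (fun x k m => R x k m \/ S x k m). split.
  - now apply decid_or.
  - intros x Y. rewrite h, h'. firstorder.
Qed.

Lemma sigma_class_ex B {T U} `{Enc T} `{Enc U} (V : T -> U -> nset -> Prop) :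
  sigma_class B (fun t : T * U => V (fst t) (snd t)) -> sigma_class B (fun x Y => exists u, V x u Y).
Proof.
  intros [R [HR h]].
  (* the prefix is lengthened so that the witness [u] can be bounded by its length *)
  exists (fun x k m => exists n, n < k /\ exists k', k' < k /\ exists m', m' < k /\
    eq_below k' (bits m') (bits m) /\ R (x, dec n) k' m'). split.
  - apply (decid_bex B (fun (t : T * (nat * nat)) n => exists k', k' < fst (snd t) /\ exists m', m' < fst (snd t) /\
      eq_below k' (bits m') (bits (snd (snd t))) /\ R (fst t, dec n) k' m') (fun t => fst (snd t))); [|cpt].
    apply (decid_bex B (fun (t : (T * (nat * nat)) * nat) k' => exists m', m' < fst (snd (fst t)) /\
      eq_below k' (bits m') (bits (snd (snd (fst t)))) /\ R (fst (fst t), dec (snd t)) k' m') (fun t => fst (snd (fst t)))); [|cpt].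
    apply (decid_bex B (fun (t : ((T * (nat * nat)) * nat) * nat) m' =>
      eq_below (snd t) (bits m') (bits (snd (snd (fst (fst t))))) /\ R (fst (fst (fst t)), dec (snd (fst t))) (snd t) m')
      (fun t => fst (snd (fst (fst t))))); [|cpt].
    apply decid_and; [apply decid_eq_below_bits; cpt|].
    refine (decid_app B (fun t : (((T * (nat * nat)) * nat) * nat) * nat =>
      ((fst (fst (fst (fst t))), dec (snd (fst (fst t))) : U), (snd (fst t), snd t)))
      (fun t => R (fst t) (fst (snd t)) (snd (snd t))) HR _). cpt.
  - intros x Y. split.
    + intros [u hu]. destruct (proj1 (h (x, u) Y) hu) as [k' [m' [h1 h2]]].
      set (k := S (enc u + k' + m')). destruct (prefix_exists Y k) as [m [_ hm]].
      exists k, m. split; auto. exists (enc u). split; [unfold k; lia|]. exists k'. split; [unfold k; lia|].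
      exists m'. split; [unfold k; lia|]. rewrite dec_enc. split; auto.
      eapply eq_below_trans; [exact h1|]. apply eq_below_sym. apply (eq_below_le k' k); auto. unfold k. lia.
    + intros [k [m [hm [n [hn [k' [hk' [m' [hm' [h1 h2]]]]]]]]]]. exists (dec n). apply (h (x, dec n)).
      exists k', m'. split; auto. eapply eq_below_trans; [exact h1|]. apply (eq_below_le k' k); auto. lia.
Qed.

Lemma sigma_class_and_decid B {T} `{Enc T} (P : T -> Prop) (V : T -> nset -> Prop) :
  decid B P -> sigma_class B V -> sigma_class B (fun x Y => P x /\ V x Y).
Proof.
  intros HP [R [HR h]]. exists (fun x k m => P x /\ R x k m). split.
  - apply decid_and; dcd.
  - intros x Y. rewrite h. firstorder.
Qed.

Lemma sigma_class_app B {T U} `{Enc T} `{Enc U} (V : U -> nset -> Prop) (f : T -> U) :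
  sigma_class B V -> computable B f -> sigma_class B (fun x => V (f x)).
Proof.
  intros [R [HR h]] Hf. exists (fun x => R (f x)). split; [|intros; apply h].
  refine (decid_app B (fun t : T * (nat * nat) => (f (fst t), snd t))
      (fun t => R (fst t) (fst (snd t)) (snd (snd t))) HR _). cpt.
Qed.

(** By the fan theorem an open set is everything exactly when, for some [N], cylinders enumerated
    below [N] contain every string of length [N]. This trades a quantifier over sets for one over
    numbers. *)
Lemma compactness B {T} `{Enc T} (V : T -> nset -> Prop) :
  sigma_class B V -> semi B (fun x => forall Y, V x Y).
Proof.
  intros [R [HR h]].
  exists (fun x N => forall m0, m0 < 2 ^ N -> exists k, k < N /\ exists m, m < N /\
    eq_below k (bits m) (bits m0) /\ R x k m). split.
  - apply (decid_ball B (fun (t : T * nat) m0 => exists k, k < snd t /\ exists m, m < snd t /\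
      eq_below k (bits m) (bits m0) /\ R (fst t) k m) (fun t => 2 ^ snd t)); [|cpt].
    apply (decid_bex B (fun (t : (T * nat) * nat) k => exists m, m < snd (fst t) /\
      eq_below k (bits m) (bits (snd t)) /\ R (fst (fst t)) k m) (fun t => snd (fst t))); [|cpt].
    apply (decid_bex B (fun (t : ((T * nat) * nat) * nat) m =>
      eq_below (snd t) (bits m) (bits (snd (fst t))) /\ R (fst (fst (fst t))) (snd t) m)
      (fun t => snd (fst (fst t)))); [|cpt].
    apply decid_and; [apply decid_eq_below_bits; cpt|].
    refine (decid_app B (fun t : (((T * nat) * nat) * nat) * nat =>
      (fst (fst (fst (fst t))), (snd (fst t), snd t)))
      (fun t => R (fst t) (fst (snd t)) (snd (snd t))) HR _). cpt.
  - intros x. split.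
    + intros HV. destruct (fan (R x)) as [N HN]; [intros Y; apply h, HV|].
      exists N. intros m0 _. destruct (HN (bits m0)) as [k [m [? [? ?]]]]. eauto 10.
    + intros [N HN] Y. destruct (prefix_exists Y N) as [m0 [h0 hm0]].
      destruct (HN m0 h0) as [k [hk [m [hm [h1 h2]]]]]. apply h. exists k, m. split; auto.
      eapply eq_below_trans; [exact h1|]. apply (eq_below_le k N); auto. lia.
Qed.

(* Indices are decided in turn: [D e] lists those [i < e] for which halting is
   avoided, and [e] joins the list unless this would empty the class. The jump
   of every member of the resulting intersection is read off from [D]. *)
Theorem low_basis B (U : nset -> Prop) :
  sigma_class B (fun _ : nat => U) -> (exists Y, ~ U Y) ->
  exists P, ~ U P /\ turing_le (jump (join P B)) (jump B).
Proof.
  intros HU Hne.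
  (* [V d] is the complement of the closed class in which no program listed in [d] halts, so the
     class is empty when [V d] holds everywhere. *)
  set (V := fun (d : list nat) Y => U Y \/ exists i, In i d /\ halts (join Y B) i i).
  assert (HV : sigma_class B V).
  { apply sigma_class_or.
    - apply (sigma_class_app B (fun _ : nat => U) (fun _ : list nat => 0)); auto. cpt.
    - apply (sigma_class_ex B (fun (d : list nat) i Y => In i d /\ halts (join Y B) i i)).
      apply sigma_class_and_decid; [dcd|]. apply sigma_class_halts; cpt. }
  pose proof (decid_jump B _ (compactness B V HV)) as HE.
  set (D := fun n => nat_rect (fun _ => list nat) []
    (fun e d => if excluded_middle_informative (forall Y, V (e :: d) Y) then d else e :: d) n).
  assert (HD : computable (jump B) D).
  { apply (comp_rec (jump B) (fun _ : nat => []) (fun _ e d =>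
      if excluded_middle_informative (forall Y, V (e :: d) Y) then d else e :: d) (fun n => n)); try cpt.
    apply (comp_ite (jump B) (fun t : nat * (nat * list nat) => forall Y, V (fst (snd t) :: snd (snd t)) Y));
      try cpt.
    apply (decid_app (jump B) (fun t : nat * (nat * list nat) => fst (snd t) :: snd (snd t))
      (fun d => forall Y, V d Y)); auto. cpt. }
  assert (Dstep : forall n, D (S n) = if excluded_middle_informative (forall Y, V (n :: D n) Y)
      then D n else n :: D n) by reflexivity.
  assert (Dinv : forall n, ~ forall Y, V (D n) Y).
  { induction n as [|n IH].
    - intros h. destruct Hne as [Y HY]. apply HY. destruct (h Y) as [?|[i [[] _]]]; auto.
    - rewrite Dstep. now destruct excluded_middle_informative. }
  assert (Dmono : forall n n' Y, n <= n' -> V (D n) Y -> V (D n') Y).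
  { intros n n' Y Hn. induction Hn as [|n' _ IH]; auto. intros h. specialize (IH h).
    rewrite Dstep. destruct excluded_middle_informative; auto.
    destruct IH as [?|[i [? ?]]]; [now left|]. right. exists i. simpl. auto. }
  assert (exists P, forall n, ~ V (D n) P) as [P HP].
  { apply NNPP. intros hP. destruct HV as [R [_ HR]].
    destruct (fan_increasing (fun n => R (D n))) as [n Hn].
    - intros n n' Y hn. rewrite <- !HR. now apply Dmono.
    - intros Y. apply NNPP. intros h. apply hP. exists Y. intros n hn. apply h. exists n. now apply HR.
    - apply (Dinv n). intros Y. apply HR, Hn. }
  exists P. split; [intros h; apply (HP 0); now left|].
  (* Program [e] halts on [P] exactly when it was refused, because its avoidance would have emptied
     the class. *)
  apply turing_le_decid. apply decid_ext with (fun e => forall Y, V (e :: D e) Y).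
  - intros e. change (jump (join P B) e) with (halts (join P B) e e). split.
    + intros h. destruct (h P) as [h'|[i [[<-|hi] h']]]; auto; exfalso; apply (HP e); [now left|].
      right. eauto.
    + intros h. apply NNPP. intros h'. apply (HP (S e)). rewrite Dstep.
      destruct excluded_middle_informative; [tauto|]. right. exists e. simpl. auto.
  - apply (decid_app (jump B) (fun e => e :: D e) (fun d => forall Y, V d Y)); auto. cpt.
Qed.

Lemma sigma_class_mem B {T} `{Enc T} (f : T -> nat) :
  computable B f -> sigma_class B (fun x Y => Y (f x)).
Proof.
  intros Hf. exists (fun x k m => f x < k /\ bits m (f x)). split.
  - apply decid_and; [dcd|]. apply decid_bits; cpt.
  - intros x Y. split.
    + intros h. destruct (prefix_exists Y (S (f x))) as [m [_ hm]]. exists (S (f x)), m.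
      split; auto. split; [lia|]. apply hm; [lia|auto].
    + intros [k [m [hm [h1 h2]]]]. now apply hm.
Qed.

Lemma sigma_class_not_mem B {T} `{Enc T} (f : T -> nat) :
  computable B f -> sigma_class B (fun x Y => ~ Y (f x)).
Proof.
  intros Hf. exists (fun x k m => f x < k /\ ~ bits m (f x)). split.
  - apply decid_and; [dcd|]. apply decid_not, decid_bits; cpt.
  - intros x Y. split.
    + intros h. destruct (prefix_exists Y (S (f x))) as [m [_ hm]]. exists (S (f x)), m.
      split; auto. split; [lia|]. intros hb. apply h, hm; [lia|auto].
    + intros [k [m [hm [h1 h2]]]] h. apply h2. now apply hm.
Qed.

(** * Degrees computing separations *)

(* Equivalently, [P] computes a separating set for every disjoint pair of
   [B]-c.e. sets: [P] has PA degree over [B]. *)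
Definition pa_over (B P : nset) : Prop :=
  forall S0 S1 : nat -> Prop, semi B S0 -> semi B S1 ->
  exists b : nat -> Prop, decid P b /\
    forall x, ~ (S0 x /\ S1 x) -> (b x -> ~ S0 x) /\ (~ b x -> ~ S1 x).

(** For two programs and an argument, a member of the class names one program that does not halt
    strictly before the other. Where at most one of them halts, the named one does not halt at
    all. *)
Lemma low_pa_exists B :
  exists P, turing_le B P /\ turing_le (jump P) (jump B) /\ pa_over B P.
Proof.
  set (first c c' x k := halts_in B c x k /\ ~ halts_in B c' x k).
  set (V := fun (t : nat * (nat * nat)) (k : nat) (Y : nset) =>
    (first (fst t) (fst (snd t)) (snd (snd t)) k /\ Y (enc t)) \/
    (first (fst (snd t)) (fst t) (snd (snd t)) k /\ ~ Y (enc t))).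
  destruct (low_basis B (fun Y => exists t k, V t k Y)) as [P [HP Hlow]].
  - apply (sigma_class_ex B (fun (_ : nat) t Y => exists k, V t k Y)).
    apply (sigma_class_ex B (fun (s : nat * (nat * (nat * nat))) k Y => V (snd s) k Y)).
    assert (HF : forall c c' x k : (nat * (nat * (nat * nat))) * nat -> nat,
      computable B c -> computable B c' -> computable B x -> computable B k ->
      decid B (fun s => first (c s) (c' s) (x s) (k s))).
    { intros c c' x k Hc Hc' Hx Hk. pose proof (decid_oracle B). unfold first.
      apply decid_and; [|apply decid_not]; apply (decid_halts_in B (fun _ => B)); auto; dcd. }
    unfold V. apply sigma_class_or; apply sigma_class_and_decid.
    + apply HF; cpt.
    + apply (sigma_class_mem B (fun s : (nat * (nat * (nat * nat))) * nat => enc (snd (fst s)))). cpt.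
    + apply HF; cpt.
    + apply (sigma_class_not_mem B (fun s : (nat * (nat * (nat * nat))) * nat => enc (snd (fst s)))). cpt.
  - set (before := fun t : nat * (nat * nat) => exists k, first (fst t) (fst (snd t)) (snd (snd t)) k).
    (* The true outcome of every race is a member, so the class is nonempty. *)
    exists (fun n => ~ before (dec n)). intros [t [k [[h1 h2]|[h1 h2]]]]; rewrite dec_enc in h2.
    + apply h2. now exists k.
    + apply NNPP in h2 as [k' [h3 h4]]. destruct h1 as [h1 h1'].
      destruct (Nat.le_ge_cases k k'); [apply h4|apply h1']; eapply halts_in_mono; eauto.
  - exists (join P B). split; [apply join_le_r|]. split; [exact Hlow|].
    intros S0 S1 HS0 HS1. destruct (semi_code B S0 HS0) as [p0 Hp0]. destruct (semi_code B S1 HS1) as [p1 Hp1].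
    assert (Hh : forall p x, (exists v, eval B p (enc x) v) <-> halts B (code p) x).
    { intros p x. split; [intros h; now exists p|]. intros [q [Hq h]]. apply code_inj in Hq. now subst. }
    exists (fun x => P (enc (code p0, (code p1, x)))). split.
    + pose proof (decid_le_oracle P (join P B) _ (join_le_l P B) (decid_oracle P)) as HPd.
      refine (decid_app (join P B) (fun x => enc (code p0, (code p1, x))) (fun n => P n) HPd _). cpt.
    + intros x. rewrite Hp0, Hp1, !Hh, !halts_iff. intros hn. split.
      * intros hb [k hk]. apply HP. exists (code p0, (code p1, x)), k. left. split; auto.
        split; auto. intros hk'. apply hn. eauto.
      * intros hb [k hk]. apply HP. exists (code p0, (code p1, x)), k. right. split; auto.
        split; auto. intros hk'. apply hn. eauto.
Qed.

(** Here [fin pos (pair n m)] says that the length-[n] pattern [m], extended by the bit [pos], is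
    realized by only finitely many [z]. This is semidecidable over [jump Q]. If [m] is realized
    infinitely often, the two extensions cannot both be finite, so a separation over [jump Q] always
    selects an extension that is still realized infinitely often. *)
Lemma pa_limit_types Q P (E : nat -> nat -> Prop) :
  decid Q (fun t : nat * nat => E (fst t) (snd t)) -> pa_over (jump Q) P ->
  exists b : nat -> Prop, decid P b /\
    forall N K, exists z, K <= z /\ forall n, n < N -> (E n z <-> b n).
Proof.
  intros HE HPA.
  set (compat := fun n m z => forall i, i < n -> (E i z <-> bits m i)).
  set (fin := fun (pos : Prop) x => exists k, forall z, k <= z ->
    ~ (compat (fst (unpair x)) (snd (unpair x)) z /\ (E (fst (unpair x)) z <-> pos))).
  assert (Hfin : forall pos, semi (jump Q) (fin pos)).
  { intros pos. unfold fin.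
    apply (semi_ex (jump Q) (fun x k => forall z, k <= z ->
      ~ (compat (fst (unpair x)) (snd (unpair x)) z /\ (E (fst (unpair x)) z <-> pos)))).
    apply semi_decid.
    apply decid_ext with (fun t : nat * nat => ~ exists z, snd t <= z /\
      (compat (fst (unpair (fst t))) (snd (unpair (fst t))) z /\ (E (fst (unpair (fst t))) z <-> pos)));
      [intros t; firstorder|].
    apply decid_not, decid_jump.
    apply (semi_ex Q (fun (t : nat * nat) z => snd t <= z /\
      (compat (fst (unpair (fst t))) (snd (unpair (fst t))) z /\ (E (fst (unpair (fst t))) z <-> pos)))).
    apply semi_decid. unfold compat.
    assert (decid Q (fun t : ((nat * nat) * nat) * nat => bits (snd (unpair (fst (fst (fst t))))) (snd t)))
      by (apply decid_bits; cpt).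
    dcd. }
  destruct (HPA (fin True) (fin False) (Hfin True) (Hfin False)) as [b [Hb HbS]].
  (* [M n] codes the first [n] bits of the branch obtained by following [b]. *)
  set (M := fun n => nat_rect (fun _ => nat) 0
    (fun n m => if excluded_middle_informative (b (pair n m)) then m + 2 ^ n else m) n).
  assert (HM : computable P M).
  { apply (comp_rec P (fun _ : nat => 0) (fun _ n m => if excluded_middle_informative (b (pair n m))
      then m + 2 ^ n else m) (fun n => n)); cpt. }
  assert (MS : forall n, M (S n) = if excluded_middle_informative (b (pair n (M n)))
    then M n + 2 ^ n else M n) by reflexivity.
  assert (Minv : forall n, M n < 2 ^ n /\ forall K, exists z, K <= z /\ compat n (M n) z).
  { induction n as [|n [IH1 IH2]].
    - split; [simpl; lia|]. intros K. exists K. split; auto. intros i hi. lia.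
    - destruct (HbS (pair n (M n))) as [h1 h2].
      { unfold fin. rewrite unpair_pair. cbn [fst snd]. intros [[k hk] [k' hk']].
        destruct (IH2 (k + k')) as [z [hz h]]. destruct (classic (E n z)) as [e|e].
        - apply (hk z); [lia|]. split; auto. tauto.
        - apply (hk' z); [lia|]. split; auto. tauto. }
      assert (G : forall pos, ~ fin pos (pair n (M n)) -> forall K, exists z, K <= z /\ compat n (M n) z /\ (E n z <-> pos)).
      { intros pos h K. unfold fin in h. rewrite unpair_pair in h. cbn [fst snd] in h.
        apply NNPP. intros h'. apply h. exists K. intros z hz hc. apply h'. eauto. }
      rewrite MS. destruct excluded_middle_informative as [hb|hb].
      + split; [simpl; lia|]. intros K. destruct (G True (h1 hb) K) as [z [hz [hc he]]].
        exists z. split; auto. intros i hi. rewrite bits_add_pow by auto.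
        destruct (Nat.eq_dec i n) as [->|hne]; [tauto|]. rewrite (hc i) by lia. tauto.
      + split; [simpl; lia|]. intros K. destruct (G False (h2 hb) K) as [z [hz [hc he]]].
        exists z. split; auto. intros i hi.
        destruct (Nat.eq_dec i n) as [->|hne]; [|apply hc; lia].
        pose proof (bits_top n (M n) n IH1 (Nat.le_refl n)). tauto. }
  assert (Mbits : forall n i, i < n -> (bits (M n) i <-> bits (M (S i)) i)).
  { intros n i hi. induction hi as [|n hi IH]; [tauto|]. rewrite <- IH, MS.
    destruct excluded_middle_informative; [|tauto]. rewrite bits_add_pow by apply Minv.
    split; auto. intros [->|?]; auto. lia. }
  exists (fun n => bits (M (S n)) n). split.
  - apply decid_bits; cpt.
  - intros N K. destruct (proj2 (Minv N) K) as [z [hz hc]]. exists z. split; auto.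
    intros n hn. rewrite (hc n hn). now apply Mbits.
Qed.

(** * Finite sets as increasing lists *)

Lemma is_mset_snoc m a z : is_mset (S m) (a ++ [z]) <-> is_mset m a /\ forall y, In y a -> y < z.
Proof.
  unfold is_mset. rewrite length_app. simpl. split.
  - intros [hl hs]. split; [split; [lia|]|]; clear hl.
    + induction a as [|y a IH]; [constructor|]. simpl in hs. inversion hs as [|? ? h1 h2]; subst.
      constructor; auto. apply Forall_app in h2. tauto.
    + induction a as [|y a IH]; [easy|]. simpl in hs. inversion hs as [|? ? h1 h2]; subst.
      intros y' [<-|hy]; auto. rewrite Forall_app in h2. destruct h2 as [_ h2]. now inversion h2.
  - intros [[hl hs] hz]. split; [lia|]. clear hl.
    induction a as [|y a IH]; [repeat constructor|]. simpl. inversion hs as [|? ? h1 h2]; subst.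
    constructor.
    + apply IH; auto. intros; apply hz. now right.
    + apply Forall_app. split; auto. constructor; auto. apply hz. now left.
Qed.

Lemma mset_snoc_inv m s : is_mset (S m) s ->
  exists a z, s = a ++ [z] /\ is_mset m a /\ forall y, In y a -> y < z.
Proof.
  intros hs. destruct (exists_last (l := s)) as [a [z ->]].
  - intros ->. now destruct hs.
  - exists a, z. split; auto. now apply is_mset_snoc.
Qed.

Section Increasing.
Context (x : nat -> nat) (Hx : forall n, x n < x (S n)).

Lemma increasing_lt i j : i < j -> x i < x j.
Proof. induction 1 as [|j _ IH]; auto. specialize (Hx j). lia. Qed.

Lemma increasing_le i j : i <= j -> x i <= x j.
Proof. intros h. destruct (Nat.eq_dec i j) as [->|]; auto. apply Nat.lt_le_incl, increasing_lt. lia. Qed.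

Lemma increasing_inj i j : x i = x j -> i = j.
Proof.
  intros E. destruct (Nat.lt_trichotomy i j) as [h|[h|h]]; auto; apply increasing_lt in h; lia.
Qed.

Lemma increasing_ge n : n <= x n.
Proof. induction n as [|n IH]; [lia|]. specialize (Hx n). lia. Qed.

Lemma is_mset_map m s : is_mset m s -> is_mset m (map x s).
Proof.
  intros [hl hs]. split; [now rewrite length_map|]. clear hl.
  induction hs as [|a s hs IH h]; simpl; constructor; auto.
  rewrite Forall_forall in *. intros y hy. apply in_map_iff in hy as [i [<- hi]].
  apply increasing_lt. auto.
Qed.

Lemma is_mset_unmap m s (H : nset) : is_mset m s -> (forall y, In y s -> exists i, x i = y /\ H i) ->
  exists t, s = map x t /\ is_mset m t /\ forall i, In i t -> H i.
Proof.
  intros [hl hs]. revert m hl. induction hs as [|a s hs IH h]; intros m hl hH.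
  - exists []. repeat split; auto. constructor. easy.
  - destruct (IH (length s)) as [t [-> [[h1 h2] h3]]]; [reflexivity|intros; apply hH; now right|].
    destruct (hH a) as [i [<- hi]]; [now left|]. exists (i :: t). split; [reflexivity|]. split.
    + split; [simpl in *; rewrite length_map in *; lia|]. constructor; auto.
      rewrite Forall_forall in *. intros j hj.
      specialize (h (x j) (in_map x t j hj)). destruct (Nat.lt_ge_cases i j) as [?|hji]; auto.
      apply increasing_le in hji. lia.
    + intros j [<-|hj]; auto.
Qed.

Lemma map_increasing_inj s t : map x s = map x t -> s = t.
Proof.
  revert t. induction s as [|i s IH]; intros [|j t] E; try discriminate; auto.
  simpl in E. injection E as E1 E2. apply increasing_inj in E1. f_equal; auto.
Qed.
End Increasing.

(** A bound on the codes of lists of length [m] with entries up to [M]; quantifiers over finite sets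
    below a point become bounded by it. *)
Fixpoint list_bound (m M : nat) : nat :=
  match m with 0 => 0 | S m => S (pair M (list_bound m M)) end.

Lemma list_bound_spec M (s : list nat) : (forall y, In y s -> y <= M) -> enc s <= list_bound (length s) M.
Proof.
  induction s as [|a s IH]; intros h; [simpl; lia|]. rewrite enc_cons. simpl list_bound.
  apply le_n_S, pair_mono; [apply h; now left|]. apply IH. intros; apply h. now right.
Qed.

Lemma comp_list_bound A {T} `{Enc T} m (M : T -> nat) : computable A M -> computable A (fun x => list_bound m (M x)).
Proof. intros HM. induction m as [|m IH]; simpl list_bound; cpt. Qed.

Lemma max_bound (l : list nat) : exists b, forall y, In y l -> y <= b.
Proof. exists (list_max l). apply Forall_forall, list_max_le. lia. Qed.

(** Three such [z] above all of [a] would give three sets of color [c]. *)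
Lemma k_bounded_cofinite m f a c :
  k_bounded (S m) 2 f -> is_mset m a -> exists K, forall z, K <= z -> f (a ++ [z]) <> c.
Proof.
  intros Hf Ha. apply NNPP. intros h.
  assert (G : forall K, exists z, K <= z /\ f (a ++ [z]) = c).
  { intros K. apply NNPP. intros h'. apply h. exists K. intros z hz e. apply h'. eauto. }
  destruct (max_bound a) as [b hb].
  destruct (G (S b)) as [z1 [h1 e1]]. destruct (G (S z1)) as [z2 [h2 e2]].
  destruct (G (S z2)) as [z3 [h3 e3]].
  specialize (Hf c [a ++ [z1]; a ++ [z2]; a ++ [z3]]). enough (3 <= 2) by lia. apply Hf.
  - assert (forall z z', a ++ [z] = a ++ [z'] -> z = z') as Hinj.
    { intros z z' e. apply app_inv_head in e. congruence. }
    apply NoDup_cons; [intros [e|[e|[]]]; apply Hinj in e; lia|].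
    apply NoDup_cons; [intros [e|[]]; apply Hinj in e; lia|].
    apply NoDup_cons; [intros []|apply NoDup_nil].
  - assert (forall z, S b <= z -> is_mset (S m) (a ++ [z])).
    { intros z hz. apply is_mset_snoc. split; auto. intros y hy. specialize (hb y hy). lia. }
    intros s [<-|[<-|[<-|[]]]]; split; auto; apply H; lia.
Qed.

(** * Reducing the exponent *)

(** The rainbow for [f] is the image of [H] under [x]. Two of its sets with different last elements
    have different colors by the thinning of [x]. If the last elements agree, equal colors make the
    initial parts equivalent, hence equal in [h], hence identical. *)
Lemma exponent_reduction Q P m f :
  turing_le Q P -> pa_over (jump Q) P -> computable Q f -> k_bounded (S m) 2 f ->
  exists h, computable P h /\ k_bounded m 2 h /\
    forall H, infinite H -> rainbow m h H ->
      exists R, turing_le R (join H P) /\ infinite R /\ rainbow (S m) f R.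
Proof.
  intros HQP HPA HfQ Hbd.
  (* [b] is the type of a set of arguments along which each equality
     [f (s, z) = f (t, z)] is eventually decided. The sequence [x] follows this type,
     and skips the finitely many [z] giving [s, z] a color already used below. *)
  set (E := fun n z => f (dec (fst (unpair n)) ++ [z]) = f (dec (snd (unpair n)) ++ [z])).
  destruct (pa_limit_types Q P E) as [b [Hb Htypes]]; auto.
  { unfold E. dcd. }
  pose proof (computable_le Q P f HQP HfQ) as HfP.
  (* The bounds reach all codes of pairs of [m]-sets, and of [m]-sets and [(m+1)]-sets, with entries
     up to [x]; the added [S] makes the strict inequalities include the bound. *)
  set (step := fun x z => x < z /\
    ((forall n, n < S (pair (list_bound m x) (list_bound m x)) -> (E n z <-> b n)) /\
    (forall i, i < S (list_bound m x) -> forall j, j < S (list_bound (S m) x) ->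
       is_mset m (dec i) -> f (dec i ++ [z]) <> f (dec j)))).
  destruct (comp_iterate P step (fun _ => True) 0) as [x [HxP [_ Hstep]]]; auto.
  { unfold step, E.
    assert (forall k, computable P (fun t : nat * nat => list_bound k (fst t))) by (intros; apply comp_list_bound; cpt).
    assert (forall k, computable P (fun t : (nat * nat) * nat => list_bound k (fst (fst t)))) by (intros; apply comp_list_bound; cpt).
    assert (decid P (fun t : ((nat * nat) * nat) * nat => is_mset m (dec (snd (fst t)))))
      by (apply (decid_is_mset P (fun _ => m)); cpt).
    pose proof (H m). pose proof (H (S m)). pose proof (H0 m). pose proof (H0 (S m)). clear H H0.
    dcd. }
  (* Each of the finitely many clashes occurs for finitely many [z] only. Past a common bound [K]
     the type [b] is still realized. *)
  { intros y _.
    destruct (bounded_choice (fun i K => forall j, j < S (list_bound (S m) y) -> is_mset m (dec i) ->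
      forall z, K <= z -> f (dec i ++ [z]) <> f (dec j)) (S (list_bound m y))) as [K HK].
    - intros i K K' hK h j hj hi z hz. apply h; auto. lia.
    - intros i _.
      destruct (bounded_choice (fun j K => is_mset m (dec i) ->
        forall z, K <= z -> f (dec i ++ [z]) <> f (dec j)) (S (list_bound (S m) y))) as [K HK].
      + intros j K K' hK h hi z hz. apply h; auto. lia.
      + intros j _. destruct (classic (is_mset m (dec i))) as [hi|hi]; [|exists 0; tauto].
        destruct (k_bounded_cofinite m f (dec i) (f (dec j)) Hbd hi) as [K HK]. exists K. auto.
      + exists K. auto.
    - destruct (Htypes (S (pair (list_bound m y) (list_bound m y))) (S (y + K))) as [z [hz hE]].
      exists z. split; [lia|]. split; auto. intros i hi j hj hm. apply HK; auto. lia. }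
  assert (Hx : forall n, x n < x (S n)) by (intros n; apply Hstep).
  set (sim := fun s t : list nat => b (pair (enc (map x s)) (enc (map x t)))).
  assert (Hbound : forall k s j, length s = k -> (forall i, In i s -> i <= j) ->
    enc (map x s) <= list_bound k (x j)).
  { intros k s j <- hs. rewrite <- (length_map x s). apply list_bound_spec.
    intros y hy. apply in_map_iff in hy as [i [<- hi]]. apply increasing_le; auto. }
  (* When [x (S j)] was chosen, all sets with indices up to [j] were already within the bound, so it
     obeys the type on them. *)
  assert (Hsim : forall s t j, is_mset m s -> is_mset m t ->
    (forall i, In i s -> i <= j) -> (forall i, In i t -> i <= j) ->
    (sim s t <-> f (map x s ++ [x (S j)]) = f (map x t ++ [x (S j)]))).
  { intros s t j hs ht hsj htj. destruct (Hstep j) as [_ [_ [hE _]]]. unfold sim.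
    rewrite <- (hE (pair (enc (map x s)) (enc (map x t)))).
    - unfold E. rewrite unpair_pair. cbn [fst snd]. now rewrite !dec_enc.
    - apply Nat.lt_succ_r, pair_mono; apply Hbound; auto; [apply hs|apply ht]. }
  (* At a common later point [sim] becomes equality of colors, which is an equivalence. *)
  assert (Hsymtr : forall s t u, is_mset m s -> is_mset m t -> is_mset m u -> sim s t -> sim u t -> sim s u).
  { intros s t u hs ht hu. destruct (max_bound (s ++ t ++ u)) as [j hj].
    assert (forall v, incl v (s ++ t ++ u) -> forall i, In i v -> i <= j) as hj' by (intros; apply hj; auto).
    assert (incl s (s ++ t ++ u)) by (apply incl_appl, incl_refl).
    assert (incl t (s ++ t ++ u)) by (apply incl_appr, incl_appl, incl_refl).
    assert (incl u (s ++ t ++ u)) by (apply incl_appr, incl_appr, incl_refl).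
    rewrite (Hsim s t j), (Hsim u t j), (Hsim s u j) by eauto. congruence. }
  assert (Hrefl : forall s, is_mset m s -> sim s s).
  { intros s hs. destruct (max_bound s) as [j hj]. now apply (Hsim s s j). }
  (* The new color of [s] is the least code of a member of its [sim]-class. *)
  set (Rh := fun (s : list nat) t => (is_mset m s /\ is_mset m (dec t) /\ sim (dec t) s /\
      forall t', t' < t -> is_mset m (dec t') -> ~ sim (dec t') s) \/ ~ is_mset m s).
  destruct (comp_select P Rh) as [h [HhP Hh]].
  { unfold Rh, sim.
    assert (decid P (fun t : list nat * nat => is_mset m (fst t))) by (apply (decid_is_mset P (fun _ => m)); cpt).
    assert (decid P (fun t : list nat * nat => is_mset m (dec (snd t)))) by (apply (decid_is_mset P (fun _ => m)); cpt).
    assert (decid P (fun t : (list nat * nat) * nat => is_mset m (dec (snd t)))) by (apply (decid_is_mset P (fun _ => m)); cpt).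
    dcd. }
  { intros s. destruct (classic (is_mset m s)) as [hs|hs]; [|exists 0; now right].
    destruct (least_exists (fun t => is_mset m (dec t) /\ sim (dec t) s)) as [t [[h1 h2] h3]].
    - exists (enc s). rewrite dec_enc. auto.
    - exists t. left. split; auto. split; auto. split; auto. intros t' ht' k1 k2. apply (h3 t'); auto. }
  assert (Hspec : forall s, is_mset m s -> is_mset m (dec (h s)) /\ sim (dec (h s)) s /\
      forall t', t' < h s -> is_mset m (dec t') -> ~ sim (dec t') s).
  { intros s hs. destruct (Hh s); tauto. }
  assert (Hclass : forall s t, is_mset m s -> is_mset m t -> sim s t -> h s = h t).
  { intros s t hs ht hst. destruct (Hspec s hs) as [k1 [k2 k3]], (Hspec t ht) as [l1 [l2 l3]].
    assert (hts : sim t s) by (apply (Hsymtr t t s); auto).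
    destruct (Nat.lt_trichotomy (h s) (h t)) as [e|[e|e]]; auto; exfalso.
    - apply (l3 _ e k1). apply (Hsymtr (dec (h s)) s t); auto.
    - apply (k3 _ e l1). apply (Hsymtr (dec (h t)) t s); auto. }
  exists h. split; [exact HhP|]. split.
  - intros y l Hnd Hl. destruct l as [|s0 l0]; [simpl; lia|]. remember (s0 :: l0) as l eqn:El.
    (* A color of [h] codes a representative of its class. Joined to a late [x (S j)], all members
       of the class get the same [f]-color as this representative, so 2-boundedness passes from [f]
       to [h]. *)
    assert (Hy : is_mset m (dec y)).
    { destruct (Hl s0) as [h1 <-]; [subst; now left|]. now apply Hspec. }
    destruct (max_bound (dec y ++ concat l)) as [j hj].
    assert (hjy : forall i, In i (dec y) -> i <= j) by (intros; apply hj, in_or_app; auto).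
    assert (hjl : forall s i, In s l -> In i s -> i <= j).
    { intros s i hs hi. apply hj, in_or_app. right. apply in_concat. eauto. }
    rewrite <- (length_map (fun s => map x s ++ [x (S j)]) l).
    apply (Hbd (f (map x (dec y) ++ [x (S j)]))).
    + apply NoDup_map_NoDup_ForallPairs; auto. intros s t _ _ e. apply app_inv_tail in e.
      eapply map_increasing_inj; eauto.
    + intros u hu. apply in_map_iff in hu as [s [<- hs]]. destruct (Hl s hs) as [h1 h2]. split.
      * apply is_mset_snoc. split; [now apply is_mset_map|].
        intros z hz. apply in_map_iff in hz as [i [<- hi]]. apply increasing_lt; auto.
        specialize (hjl s i hs hi). lia.
      * symmetry. apply Hsim; eauto. rewrite <- h2. now apply Hspec.
  - intros H HHinf HHrb. exists (fun y => exists i, x i = y /\ H i). split; [|split].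
    + apply turing_le_decid. apply decid_ext with (fun y => exists i, i <= y /\ (x i = y /\ H i)).
      * intros y. split; [intros [i [_ ?]]; eauto|]. intros [i [<- ?]]. exists i. split; auto.
        now apply increasing_ge.
      * pose proof (computable_le P (join H P) x (join_le_r H P) HxP).
        pose proof (decid_le_oracle H (join H P) _ (join_le_l H P) (decid_oracle H)). dcd.
    + intros N. destruct (HHinf N) as [i [hi hH]]. exists (x i). split; [|eauto].
      pose proof (increasing_ge x Hx i). lia.
    (* The larger last element is some [x (S j)], which was chosen to avoid the colors of all sets
       with entries up to [x j]. *)
    + assert (Hcross : forall s t i i', is_mset (S m) (s ++ [i]) -> is_mset (S m) (t ++ [i']) -> i < i' ->
        f (map x (s ++ [i])) <> f (map x (t ++ [i']))).
      { intros s t i i' hs ht hi. destruct i' as [|j]; [lia|].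
        apply is_mset_snoc in ht as [ht htj]. destruct (Hstep j) as [_ [_ [_ hthin]]].
        specialize (hthin (enc (map x t))) as hthin1. rewrite dec_enc in hthin1.
        rewrite (map_app x t). simpl. intros e. refine (hthin1 _ (enc (map x (s ++ [i]))) _ _ _).
        - apply Nat.lt_succ_r, Hbound; [apply ht|]. intros k hk. specialize (htj k hk). lia.
        - apply Nat.lt_succ_r, Hbound; [apply hs|]. intros k hk. apply is_mset_snoc in hs as [_ hs].
          apply in_app_or in hk as [hk|[<-|[]]]; [specialize (hs k hk)|]; lia.
        - now apply is_mset_map.
        - rewrite dec_enc. auto. }
      intros s t hs ht hsR htR e.
      destruct (is_mset_unmap x Hx _ s H hs hsR) as [s' [-> [hs' hsH]]].
      destruct (is_mset_unmap x Hx _ t H ht htR) as [t' [-> [ht' htH]]]. f_equal.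
      destruct (mset_snoc_inv m s' hs') as [a [i [-> [ha hai]]]].
      destruct (mset_snoc_inv m t' ht') as [c [i' [-> [hc hci]]]].
      destruct (Nat.lt_trichotomy i i') as [hi|[<-|hi]].
      * exfalso. now apply (Hcross a c i i').
      (* Index 0 has no predecessor [j], but then nothing lies below it and both initial parts are
         empty. *)
      * f_equal. destruct i as [|j].
        { destruct a as [|k a]; [|specialize (hai k (or_introl eq_refl)); lia].
          destruct c as [|k c]; [|specialize (hci k (or_introl eq_refl)); lia]. reflexivity. }
        apply HHrb; auto.
        -- intros k hk. apply hsH, in_or_app. auto.
        -- intros k hk. apply htH, in_or_app. auto.
        -- apply Hclass; auto. rewrite !map_app in e. apply (Hsim a c j); auto.
           ++ intros k hk. specialize (hai k hk). lia.
           ++ intros k hk. specialize (hci k hk). lia.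
      * exfalso. symmetry in e. now apply (Hcross c a i' i).
Qed.

(** * Counting *)

Fixpoint cnt (N : nat) (S : nat -> Prop) : nat :=
  match N with 0 => 0 | Datatypes.S n => cnt n S + chi (S n) end.

Lemma chi_mono (P Q : Prop) : (P -> Q) -> chi P <= chi Q.
Proof. intros h. unfold chi. destruct (excluded_middle_informative P), (excluded_middle_informative Q); tauto || lia. Qed.

Lemma cnt_mono N (S S' : nat -> Prop) : (forall i, i < N -> S i -> S' i) -> cnt N S <= cnt N S'.
Proof.
  induction N as [|N IH]; intros h; simpl; auto.
  apply Nat.add_le_mono; [apply IH; auto|apply chi_mono; auto].
Qed.

Lemma cnt_ext N (S S' : nat -> Prop) : (forall i, i < N -> (S i <-> S' i)) -> cnt N S = cnt N S'.
Proof. intros h. apply Nat.le_antisymm; apply cnt_mono; intros; now apply h. Qed.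

Lemma cnt_or N (S S' : nat -> Prop) : cnt N (fun i => S i \/ S' i) <= cnt N S + cnt N S'.
Proof.
  induction N as [|N IH]; simpl; auto.
  assert (chi (S N \/ S' N) <= chi (S N) + chi (S' N)); [|lia].
  unfold chi. destruct (excluded_middle_informative (S N)), (excluded_middle_informative (S' N)),
    (excluded_middle_informative (S N \/ S' N)); tauto || lia.
Qed.

Lemma cnt_all N (S : nat -> Prop) : (forall i, i < N -> S i) -> cnt N S = N.
Proof. induction N as [|N IH]; intros h; simpl; auto. rewrite IH, chi_true by auto. lia. Qed.

Lemma cnt_none N (S : nat -> Prop) : (forall i, i < N -> ~ S i) -> cnt N S = 0.
Proof. induction N as [|N IH]; intros h; simpl; auto. rewrite IH, chi_false by auto. lia. Qed.

Lemma cnt_le N S : cnt N S <= N.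
Proof. induction N as [|N IH]; simpl; auto. pose proof (chi_le_1 (S N)). lia. Qed.

Lemma cnt_add a b S : cnt (a + b) S = cnt a S + cnt b (fun i => S (a + i)).
Proof.
  induction b as [|b IH]; simpl; [now rewrite Nat.add_0_r|].
  rewrite Nat.add_succ_r. simpl. lia.
Qed.

Lemma cnt_periodic q D (S : nat -> Prop) : 0 < D -> cnt (q * D) (fun m => S (m mod D)) = q * cnt D S.
Proof.
  intros hD. induction q as [|q IH]; [reflexivity|]. simpl Nat.mul.
  rewrite Nat.add_comm, cnt_add, IH, Nat.add_comm. f_equal.
  apply cnt_ext. intros i hi. rewrite Nat.add_comm, Nat.Div0.mod_add, Nat.mod_small by auto. tauto.
Qed.

(** [bits] lists low bits first, so [m mod 2 ^ l] is the prefix of length [l] of [m]. The measure of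
    a set that depends on [l] bits can thus be computed at any level [K] from [l] on. *)
Lemma cnt_prefix l K (S S' : nat -> Prop) :
  l <= K -> (forall m, m < 2 ^ K -> (S' m <-> S (m mod 2 ^ l))) -> cnt (2 ^ K) S' = 2 ^ (K - l) * cnt (2 ^ l) S.
Proof.
  intros hl h. rewrite <- cnt_periodic by (apply Nat.neq_0_lt_0, Nat.pow_nonzero; lia).
  rewrite <- Nat.pow_add_r. replace (K - l + l) with K by lia. now apply cnt_ext.
Qed.

Lemma cnt_le_NoDup N n (S : nat -> Prop) :
  (forall l, NoDup l -> (forall y, In y l -> S y) -> length l <= n) -> cnt N S <= n.
Proof.
  intros h. enough (exists l, NoDup l /\ (forall y, In y l -> y < N /\ S y) /\ length l = cnt N S) as [l [h1 [h2 <-]]].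
  { apply h; auto. intros y hy. now apply h2. }
  clear h. induction N as [|N [l [h1 [h2 h3]]]].
  - exists []. split; [constructor|]. split; [easy|reflexivity].
  - simpl. destruct (classic (S N)) as [e|e].
    + exists (N :: l). rewrite (chi_true _ e). split; [|split].
      * constructor; auto. intros hN. apply h2 in hN. lia.
      * intros y [<-|hy]; [auto|]. apply h2 in hy. split; [lia|tauto].
      * simpl. lia.
    + exists l. rewrite (chi_false _ e). split; [auto|]. split; [|lia].
      intros y hy. apply h2 in hy. split; [lia|tauto].
Qed.

Lemma comp_cnt A {T} `{Enc T} (n : T -> nat) (S : T -> nat -> Prop) :
  computable A n -> decid A (fun t : T * nat => S (fst t) (snd t)) -> computable A (fun x => cnt (n x) (S x)).
Proof.
  intros Hn HS. apply comp_ext with (fun x => nat_rect (fun _ => nat) 0 (fun i r => r + chi (S x i)) (n x)).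
  - intros x. induction (n x) as [|k IH]; simpl; congruence.
  - apply (comp_rec A (fun _ => 0) (fun x i r => r + chi (S x i)) n); try cpt.
Qed.

(** The sum of [2 ^ -(e + 2)] over [e < n] is [1/2 - 2 ^ -(n + 1)], here with denominators cleared;
    the subtracted term is what makes the induction work. *)
Lemma union_bound N n (S : nat -> nat -> Prop) :
  (forall e, e < n -> cnt N (S e) * 2 ^ (e + 2) <= N) ->
  2 ^ (n + 1) * cnt N (fun m => exists e, e < n /\ S e m) + N <= N * 2 ^ n.
Proof.
  induction n as [|n IH]; intros h.
  - rewrite cnt_none; [simpl; lia|]. intros i _ [e [? _]]. lia.
  - assert (IH' := IH ltac:(auto)). clear IH.
    assert (cnt N (fun m => exists e, e < Datatypes.S n /\ S e m) <=
      cnt N (fun m => exists e, e < n /\ S e m) + cnt N (S n)) as hle.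
    { etransitivity; [|apply cnt_or]. apply cnt_mono. intros i _ [e [he hi]].
      destruct (Nat.eq_dec e n) as [->|]; auto. left. exists e. split; auto. lia. }
    assert (h' := h n ltac:(auto)).
    replace (Datatypes.S n + 1) with (Datatypes.S (n + 1)) by lia.
    replace (n + 2) with (Datatypes.S (n + 1)) in h' by lia. rewrite !Nat.pow_succ_r' in *. nia.
Qed.

(** * A class of random sets *)

Section Random.
Context (Q : nset).

Let halted (e t m : nat) : Prop := halts_in (join (bits m) Q) e e t.

(* [late e s t / 2 ^ t] is the measure of the oracles on which program [e]
   halts by stage [t] but not by stage [s]. *)
Let late (e s t : nat) : nat := cnt (2 ^ t) (fun m => halted e t m /\ ~ halted e s m).

Lemma halted_mod e s m : halted e s (m mod 2 ^ s) <-> halted e s m.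
Proof.
  split; apply halts_in_use, eq_below_join; [|apply eq_below_sym]; apply bits_mod.
Qed.

Lemma late_split e s t : s <= t ->
  cnt (2 ^ t) (halted e t) <= late e s t + 2 ^ (t - s) * cnt (2 ^ s) (halted e s) /\
  late e s t + 2 ^ (t - s) * cnt (2 ^ s) (halted e s) <= cnt (2 ^ t) (halted e t).
Proof.
  intros hs. rewrite <- (cnt_prefix s t (halted e s) (halted e s)); auto.
  2:{ intros m _. symmetry. apply halted_mod. }
  unfold late. generalize (2 ^ t). intros N.
  assert (hmono : forall m, halted e s m -> halted e t m) by (intros m; now apply halts_in_mono).
  induction N as [|N IH]; simpl; [lia|].
  assert (chi (halted e t N) = chi (halted e t N /\ ~ halted e s N) + chi (halted e s N)); [|lia].
  destruct (classic (halted e s N)) as [h|h].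
  - rewrite (chi_true _ h), (chi_true (halted e t N)), chi_false; auto. tauto.
  - rewrite (chi_false _ h), Nat.add_0_r. apply chi_iff. tauto.
Qed.

(** Otherwise the measure of the halting oracles could be raised by more than [1 / D] again and
    again; after [D + 1] rounds it would exceed 1. *)
Lemma settling_stage_exists e : exists s, forall t, s <= t -> late e s t * 2 ^ (e + 3) <= 2 ^ t.
Proof.
  apply NNPP. intros hn. set (D := 2 ^ (e + 3)) in *.
  assert (hs : forall s, exists t, s <= t /\ 2 ^ t < late e s t * D).
  { intros s. apply NNPP. intros h. apply hn. exists s. intros t ht.
    apply Nat.nlt_ge. intros h'. apply h. eauto. }
  assert (hj : forall j, exists t, j * 2 ^ t <= cnt (2 ^ t) (halted e t) * D).
  { induction j as [|j [s IH]]; [exists 0; lia|]. destruct (hs s) as [t [h1 h2]].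
    exists t. pose proof (late_split e s t h1) as [_ h3].
    assert (E : 2 ^ t = 2 ^ (t - s) * 2 ^ s) by (rewrite <- Nat.pow_add_r; f_equal; lia).
    assert (2 ^ (t - s) * (j * 2 ^ s) <= 2 ^ (t - s) * (cnt (2 ^ s) (halted e s) * D))
      by now apply Nat.mul_le_mono_l.
    apply (Nat.mul_le_mono_r _ _ D) in h3.
    assert (j * 2 ^ t = 2 ^ (t - s) * (j * 2 ^ s)) by (rewrite E; lia). simpl. lia. }
  destruct (hj (S D)) as [t ht]. pose proof (cnt_le (2 ^ t) (halted e t)).
  assert (2 ^ t <> 0) by (apply Nat.pow_nonzero; lia). nia.
Qed.

Lemma decid_halted A {T} `{Enc T} (e t m : T -> nat) :
  turing_le Q A -> computable A e -> computable A t -> computable A m ->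
  decid A (fun x => halted (e x) (t x) (m x)).
Proof.
  intros HQ He Ht Hm. apply (decid_halts_in A (fun x => join (bits (m x)) Q)); auto.
  apply (decid_join A (fun (x : T * nat) => bits (m (fst x))) Q snd); [apply decid_bits; cpt| |cpt].
  apply (decid_le_oracle Q A _ HQ), decid_oracle.
Qed.

(** Being a settling stage is a universal condition over [Q], so [jump Q] can search for one. *)
Lemma settling_stage : exists s : nat -> nat, computable (jump Q) s /\
  forall e t, s e <= t -> late e (s e) t * 2 ^ (e + 3) <= 2 ^ t.
Proof.
  destruct (comp_select (jump Q) (fun e s => forall t, s <= t -> late e s t * 2 ^ (e + 3) <= 2 ^ t))
    as [s [Hs Hs']]; [|intros e; apply settling_stage_exists|eauto].
  apply decid_ext with (fun x : nat * nat => ~ exists t, snd x <= t /\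
    ~ late (fst x) (snd x) t * 2 ^ (fst x + 3) <= 2 ^ t).
  { intros x. split; [|firstorder]. intros h t ht. apply NNPP. intros h'. apply h. eauto. }
  apply decid_not, decid_jump.
  apply (semi_ex Q (fun (x : nat * nat) t => snd x <= t /\
    ~ late (fst x) (snd x) t * 2 ^ (fst x + 3) <= 2 ^ t)).
  apply semi_decid. unfold late.
  assert (computable Q (fun x : (nat * nat) * nat => cnt (2 ^ snd x)
    (fun m => halted (fst (fst x)) (snd x) m /\ ~ halted (fst (fst x)) (snd (fst x)) m))).
  { apply (comp_cnt Q (fun x => 2 ^ snd x) (fun (x : (nat * nat) * nat) m =>
      halted (fst (fst x)) (snd x) m /\ ~ halted (fst (fst x)) (snd (fst x)) m)); [cpt|].
    apply decid_and; [|apply decid_not];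
      [apply (decid_halted Q (fun y : ((nat * nat) * nat) * nat => fst (fst (fst y))) (fun y => snd (fst y)) (fun y => snd y))
      |apply (decid_halted Q (fun y : ((nat * nat) * nat) * nat => fst (fst (fst y))) (fun y => snd (fst (fst y))) (fun y => snd y))];
      try cpt; apply turing_le_refl. }
  dcd.
Qed.

Let B : nset := jump Q.

Let W (n t y : nat) : Prop := halts_in B (fst (unpair n)) (pair (snd (unpair n)) y) t.

(** Since [n <= 2 ^ n], at most [n] strings of this length have total measure at most
    [2 ^ -(n + 3)]. *)
Let width (n : nat) : nat := 2 * n + 3.

(** The stages with at most [n] elements form an initial segment, and the last of them contains
    everything that counts. A large enumerated set therefore costs no more than a small one. *)
Lemma cnt_early_enumerated n T :
  cnt (2 ^ width n) (fun y => exists t, t <= T /\ W n t y /\ cnt (2 ^ width n) (W n t) <= n) <= n.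
Proof.
  induction T as [|T IH].
  - destruct (Nat.le_gt_cases (cnt (2 ^ width n) (W n 0)) n) as [h|h].
    + etransitivity; [|exact h]. apply cnt_mono. intros y _ [t [ht [? _]]]. now replace 0 with t by lia.
    + rewrite cnt_none; [lia|]. intros y _ [t [ht [_ h']]]. replace t with 0 in h' by lia. lia.
  - destruct (Nat.le_gt_cases (cnt (2 ^ width n) (W n (S T))) n) as [h|h].
    + etransitivity; [|exact h]. apply cnt_mono. intros y _ [t [ht [h' _]]].
      now apply (halts_in_mono _ _ _ t).
    + etransitivity; [|exact IH]. apply cnt_mono. intros y _ [t [ht [h1 h2]]]. exists t.
      split; auto. destruct (Nat.eq_dec t (S T)) as [->|]; lia.
Qed.

(* [RA e] says that [e] halts after its settling stage, [RB n] that the prefix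
   of length [width n] is among the first [n] elements enumerated into the [n]-th
   [B]-c.e. set.
   Both have measure at most [2 ^ -(e + 3)], so some set escapes all of them;
   avoiding [RA] makes the jump of [join X Q] decidable from [join X B]. *)
Theorem low_random_exists :
  exists X, turing_le (jump (join X B)) (jump B) /\ turing_le (jump (join X Q)) (join X B) /\
    exists g : nat -> nat, computable X g /\ forall c x,
      (forall l, NoDup l -> (forall y, In y l -> halts B c (pair x y)) -> length l <= pair c x) ->
      g (pair c x) < 2 ^ width (pair c x) /\ ~ halts B c (pair x (g (pair c x))).
Proof.
  destruct settling_stage as [s [Hs Hlate]].
  assert (HQB : turing_le Q B) by apply le_jump.
  set (RA := fun e k m => s e <= k /\ halted e k m /\ ~ halted e (s e) m).
  set (RB := fun n k m => width n <= k /\ exists y, y < 2 ^ width n /\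
    (eq_below (width n) (bits y) (bits m) /\ W n k y /\ cnt (2 ^ width n) (W n k) <= n)).
  set (R := fun k m => exists e, e < k /\ (RA e k m \/ RB e k m)).
  destruct (low_basis B (fun X => exists k m, eq_below k (bits m) X /\ R k m)) as [X [HX Hlow]].
  - exists (fun _ => R). split; [|tauto]. unfold R.
    apply (decid_bex B (fun (t : nat * (nat * nat)) e => RA e (fst (snd t)) (snd (snd t)) \/ RB e (fst (snd t)) (snd (snd t)))
      (fun t => fst (snd t))); [|cpt].
    unfold RA, RB, width. fold B in Hs.
    assert (H1 : decid B (fun t : (nat * (nat * nat)) * nat => halted (snd t) (fst (snd (fst t))) (snd (snd (fst t)))))
      by (apply decid_halted; auto; cpt).
    assert (H2 : decid B (fun t : (nat * (nat * nat)) * nat => halted (snd t) (s (snd t)) (snd (snd (fst t)))))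
      by (apply decid_halted; auto; cpt).
    assert (H3 : decid B (fun t : ((nat * (nat * nat)) * nat) * nat =>
      eq_below (2 * snd (fst t) + 3) (bits (snd t)) (bits (snd (snd (fst (fst t)))))))
      by (apply decid_eq_below_bits; cpt).
    assert (H4 : decid B (fun t : ((nat * (nat * nat)) * nat) * nat => W (snd (fst t)) (fst (snd (fst (fst t)))) (snd t))).
    { pose proof (decid_oracle B). apply (decid_halts_in B (fun _ => B)); try cpt. dcd. }
    assert (H5 : computable B (fun t : ((nat * (nat * nat)) * nat) * nat =>
      cnt (2 ^ (2 * snd (fst t) + 3)) (W (snd (fst t)) (fst (snd (fst (fst t))))))).
    { apply (comp_cnt B (fun t : ((nat * (nat * nat)) * nat) * nat => 2 ^ (2 * snd (fst t) + 3))
        (fun t => W (snd (fst t)) (fst (snd (fst (fst t)))))); [cpt|].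
      refine (decid_app B (fun t : (((nat * (nat * nat)) * nat) * nat) * nat => (fst (fst t), snd t)) _ H4 _). cpt. }
    dcd.
  (* If the class were empty, compactness would bound the lengths needed by one [N], and counting
     strings of length [N] refutes this. *)
  - apply NNPP. intros hn.
    destruct (fan R) as [N HN].
    { intros Y. apply NNPP. intros h. apply hn. exists Y. exact h. }
    set (late_at := fun e m => s e <= N /\ halted e N m /\ ~ halted e (s e) m).
    set (hit := fun e m => width e <= N /\ exists t, t <= N /\ W e t (m mod 2 ^ width e) /\
      cnt (2 ^ width e) (W e t) <= e).
    assert (H1 : forall e, cnt (2 ^ N) (late_at e) * 2 ^ (e + 3) <= 2 ^ N).
    { intros e. destruct (Nat.le_gt_cases (s e) N) as [h|h].
      - etransitivity; [|apply (Hlate e N h)]. apply Nat.mul_le_mono_r, cnt_mono. now intros m _ [_ ?].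
      - rewrite cnt_none; [lia|]. intros m _ [? _]. lia. }
    assert (H2 : forall e, cnt (2 ^ N) (hit e) * 2 ^ (e + 3) <= 2 ^ N).
    { intros e. destruct (Nat.le_gt_cases (width e) N) as [h|h].
      - rewrite (cnt_prefix (width e) N (fun y => exists t, t <= N /\ W e t y /\ cnt (2 ^ width e) (W e t) <= e)); auto.
        2:{ intros m _. unfold hit. tauto. }
        pose proof (cnt_early_enumerated e N) as hc.
        pose proof (Nat.pow_gt_lin_r 2 e ltac:(lia)).
        (* Here [e] is replaced by [2 ^ e], after which the exponents add up to [N]. *)
        transitivity (2 ^ (N - width e) * 2 ^ e * 2 ^ (e + 3)).
        + apply Nat.mul_le_mono_r, Nat.mul_le_mono_l. lia.
        + rewrite <- !Nat.pow_add_r. apply Nat.pow_le_mono_r; [lia|]. unfold width in *. lia.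
      - rewrite cnt_none; [lia|]. intros m _ [? _]. lia. }
    assert (H3 : cnt (2 ^ N) (fun m => exists e, e < N /\ (late_at e m \/ hit e m)) = 2 ^ N).
    { apply cnt_all. intros m0 _. destruct (HN (bits m0)) as [k [m [hk [hm [he [e [hek [h|h]]]]]]]].
      - exists e. split; [lia|]. left. destruct h as [h1 [h2 h3]]. split; [lia|]. split.
        + apply (halts_in_mono _ _ _ k); [lia|]. eapply halts_in_use; [|exact h2]. now apply eq_below_join.
        + intros h4. apply h3. eapply halts_in_use; [|exact h4]. apply eq_below_join, eq_below_sym.
          now apply (eq_below_le _ k).
      - exists e. split; [lia|]. right. destruct h as [h1 [y [h2 [h3 [h4 h5]]]]]. split; [lia|].
        exists k. split; [lia|]. split; auto. replace (m0 mod 2 ^ width e) with y; auto.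
        apply (prefix_unique (width e)); auto.
        + apply Nat.mod_upper_bound, Nat.pow_nonzero. lia.
        + eapply eq_below_trans; [exact h3|]. eapply eq_below_trans; [apply (eq_below_le _ k); eauto|].
          apply eq_below_sym, bits_mod. }
    (* The two events for [e] have joint measure at most [2 ^ -(e + 2)], so all events cover at most
       half of the strings, against [H3]. *)
    pose proof (union_bound (2 ^ N) N (fun e m => late_at e m \/ hit e m)) as H4.
    cbn beta in H4. rewrite H3 in H4.
    assert (2 ^ N <> 0) by (apply Nat.pow_nonzero; lia).
    rewrite Nat.pow_add_r in H4. simpl (2 ^ 1) in H4.
    enough (2 ^ N * 2 * 2 ^ N + 2 ^ N <= 2 ^ N * 2 ^ N) by nia.
    apply H4. intros e he. specialize (H1 e). specialize (H2 e).
    pose proof (cnt_or (2 ^ N) (late_at e) (hit e)).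
    replace (e + 3) with (S (e + 2)) in * by lia. rewrite Nat.pow_succ_r' in *. nia.
  - exists X. split; [exact Hlow|]. split.
    + apply turing_le_decid. apply decid_ext with (fun e => halts_in (join X Q) e e (s e)).
      * intros e. change (jump (join X Q) e) with (halts (join X Q) e e). rewrite halts_iff.
        split; [eauto|]. intros [t ht]. apply NNPP. intros hs. apply HX.
        (* This length exceeds the index, the settling stage and the halting stage. *)
        set (k := S (e + s e + t)). destruct (prefix_exists X k) as [m [_ hm]].
        exists k, m. split; auto. exists e. split; [unfold k; lia|]. left. split; [unfold k; lia|]. split.
        -- apply (halts_in_mono _ _ _ t); [unfold k; lia|]. eapply halts_in_use; [|exact ht].
           apply eq_below_join, eq_below_sym, (eq_below_le _ k); auto. unfold k. lia.
        -- intros h. apply hs. eapply halts_in_use; [|exact h].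
           apply eq_below_join, (eq_below_le _ k); auto. unfold k. lia.
      * pose proof (computable_le B (join X B) s (join_le_r X B) Hs).
        apply (decid_halts_in (join X B) (fun _ => join X Q)); try cpt.
        apply (decid_app (join X B) snd (fun i : nat => join X Q i)); [|cpt].
        apply turing_le_decid, join_lub; [apply join_le_l|].
        apply (turing_le_trans Q B); [exact HQB|apply join_le_r].
    + destruct (comp_prefix X X (decid_oracle X)) as [f [Hf Hf']].
      exists (fun n => f (width n)). split; [unfold width; cpt|]. intros c x hc.
      set (n := pair c x) in *. split; [apply Hf'|]. intros hh. apply halts_iff in hh as [t ht].
      apply HX. set (k := S (width n + t)). destruct (prefix_exists X k) as [m [_ hm]].
      exists k, m. split; auto. exists n. split; [unfold k, width; lia|]. right. split; [unfold k; lia|].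
      exists (f (width n)). split; [apply Hf'|]. split; [|split].
      * eapply eq_below_trans; [apply Hf'|]. apply eq_below_sym, (eq_below_le _ k); auto. unfold k. lia.
      * apply (halts_in_mono _ _ _ t); [unfold k; lia|]. unfold n. rewrite unpair_pair. exact ht.
      * apply cnt_le_NoDup. intros l hl hW. apply hc; auto. intros y hy. apply halts_iff. exists k.
        specialize (hW y hy). unfold W, n in hW. rewrite unpair_pair in hW. exact hW.
Qed.
End Random.

(** * Rainbows for colorings of pairs *)

Lemma eventually_list {T} (l : list T) (P : T -> nat -> Prop) :
  (forall a, In a l -> exists K, forall z, K <= z -> P a z) ->
  exists K, forall z, K <= z -> forall a, In a l -> P a z.
Proof.
  induction l as [|a l IH]; intros h; [exists 0; intros z _ b []|].
  destruct IH as [K HK]; [intros; apply h; now right|].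
  destruct (h a) as [K' HK']; [now left|].
  exists (K + K'). intros z hz b [<-|hb]; [apply HK'; lia|apply HK; auto; lia].
Qed.

Lemma cnt_nth (S : nat -> Prop) i : infinite S -> exists z, S z /\ cnt z S = i.
Proof.
  intros hS.
  assert (G : forall i, exists N, i <= cnt N S).
  { clear i. induction i as [|i [N IH]]; [exists 0; lia|]. destruct (hS N) as [z [hz hSz]].
    exists (Datatypes.S z). simpl. rewrite (chi_true _ hSz).
    enough (cnt N S <= cnt z S) by lia. replace z with (N + (z - N)) by lia. rewrite cnt_add. lia. }
  destruct (least_exists _ (G (Datatypes.S i))) as [[|z] [h1 h2]]; [simpl in h1; lia|].
  exists z. specialize (h2 z ltac:(lia)). simpl in h1.
  destruct (classic (S z)) as [h|h].
  - rewrite (chi_true _ h) in h1. split; [auto|lia].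
  - rewrite (chi_false _ h) in h1. lia.
Qed.

Lemma is_mset_2 s : is_mset 2 s -> exists p q, s = [p; q] /\ p < q.
Proof.
  intros [hl hs]. destruct s as [|p [|q [|r s]]]; try discriminate. exists p, q. split; auto.
  inversion hs as [|? ? _ h]; subst. now inversion h.
Qed.

Lemma is_mset_pair p q : p < q -> is_mset 2 [p; q].
Proof. intros h. split; auto. repeat constructor; auto. Qed.

Section Pairs.
Context (Q : nset) (f : coloring) (HfQ : computable Q f) (Hbd : k_bounded 2 2 f).

Definition reservoir (D : list nat) (z : nat) : Prop :=
  (forall x, In x D -> x < z) /\
  (forall a, In a D -> forall b, In b D -> ~ a = b -> f [a; z] <> f [b; z]).

(** The reservoir separates pairs with the same maximum; the second clause separates the new pairs
    ending in [z] from the pairs inside [D]. *)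
Definition candidate (D : list nat) (z : nat) : Prop :=
  reservoir D z /\
  forall a, In a D -> forall b, In b D -> forall b', In b' D -> b < b' -> f [a; z] <> f [b; b'].

(* The [i]-th candidate for extending [D], where [t = (D, i)], leaves only a
   finite reservoir. *)
Definition ruined (t : list nat * nat) : Prop :=
  exists u : nat * nat, candidate (fst t) (fst u) /\ cnt (fst u) (candidate (fst t)) = snd t /\
    forall z, snd u <= z -> ~ reservoir (fst u :: fst t) z.

Lemma decid_reservoir A {T} `{Enc T} (D : T -> list nat) (z : T -> nat) :
  turing_le Q A -> computable A D -> computable A z -> decid A (fun x => reservoir (D x) (z x)).
Proof.
  intros HQ HD Hz. pose proof (computable_le Q A f HQ HfQ). unfold reservoir. dcd.
Qed.

Lemma decid_candidate A {T} `{Enc T} (D : T -> list nat) (z : T -> nat) :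
  turing_le Q A -> computable A D -> computable A z -> decid A (fun x => candidate (D x) (z x)).
Proof.
  intros HQ HD Hz. pose proof (computable_le Q A f HQ HfQ).
  pose proof (decid_reservoir A D z HQ HD Hz). unfold candidate. apply decid_and; [auto|dcd].
Qed.

(** The reservoir being empty from some point on is a universal statement over [Q], which [jump Q]
    decides. *)
Lemma semi_ruined : semi (jump Q) ruined.
Proof.
  pose proof (le_jump Q) as HQ.
  apply (semi_ex (jump Q) (fun (t : list nat * nat) (u : nat * nat) => candidate (fst t) (fst u) /\
    cnt (fst u) (candidate (fst t)) = snd t /\ forall z, snd u <= z -> ~ reservoir (fst u :: fst t) z)).
  apply semi_decid. apply decid_and; [apply decid_candidate; auto; cpt|]. apply decid_and.
  - assert (computable (jump Q) (fun t : (list nat * nat) * (nat * nat) => cnt (fst (snd t)) (candidate (fst (fst t))))).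
    { apply (comp_cnt _ (fun t : (list nat * nat) * (nat * nat) => fst (snd t)) (fun t => candidate (fst (fst t)))); [cpt|].
      apply decid_candidate; auto; cpt. }
    dcd.
  - apply decid_ext with (fun t : (list nat * nat) * (nat * nat) =>
      ~ exists z, snd (snd t) <= z /\ reservoir (fst (snd t) :: fst (fst t)) z); [intros t; firstorder|].
    apply decid_not, decid_jump.
    apply (semi_ex Q (fun (t : (list nat * nat) * (nat * nat)) z =>
      snd (snd t) <= z /\ reservoir (fst (snd t) :: fst (fst t)) z)).
    apply semi_decid, decid_and; [dcd|]. apply decid_reservoir; try cpt. apply turing_le_refl.
Qed.

(** Only finitely many colors occur inside [D], and each meets [[a; z]] for finitely many [z]. *)
Lemma infinite_candidate D : infinite (reservoir D) -> infinite (candidate D).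
Proof.
  intros hD N.
  destruct (eventually_list D (fun a z => forall b, In b D -> forall b', In b' D -> b < b' -> f [a; z] <> f [b; b'])) as [K HK].
  { intros a _. apply (eventually_list D (fun b z => forall b', In b' D -> b < b' -> f [a; z] <> f [b; b'])).
    intros b _. apply (eventually_list D (fun b' z => b < b' -> f [a; z] <> f [b; b'])).
    intros b' _. destruct (k_bounded_cofinite 1 f [a] (f [b; b']) Hbd) as [K HK].
    - split; auto. repeat constructor.
    - exists K. intros z hz _. now apply HK. }
  destruct (hD (N + K)) as [z [hz hr]]. exists z. split; [lia|]. split; auto.
  intros a ha. apply HK; auto. lia.
Qed.

Lemma three_same_color p q r z : p < z -> q < z -> r < z -> p <> q -> p <> r ->
  f [p; z] = f [q; z] -> f [p; z] = f [r; z] -> q = r.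
Proof.
  intros hp hq hr h1 h2 e1 e2. apply NNPP. intros h3.
  specialize (Hbd (f [p; z]) [[p; z]; [q; z]; [r; z]]). simpl in Hbd. enough (3 <= 2) by lia.
  apply Hbd.
  - apply NoDup_cons; [intros [e|[e|[]]]; congruence|].
    apply NoDup_cons; [intros [e|[]]; congruence|].
    apply NoDup_cons; [intros []|apply NoDup_nil].
  - intros s [<-|[<-|[<-|[]]]]; split; auto using is_mset_pair.
Qed.

(* At a far element [z] of the reservoir of [D] each ruined candidate shares
   its color with some element of [D]; 2-boundedness makes this injective. *)
Lemma ruined_length D l : infinite (reservoir D) -> NoDup l -> (forall i, In i l -> ruined (D, i)) ->
  length l <= length D.
Proof.
  intros hD hl hr.
  destruct (choice (fun i (u : nat * nat) => In i l -> candidate D (fst u) /\ cnt (fst u) (candidate D) = i /\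
     forall z, snd u <= z -> ~ reservoir (fst u :: D) z)) as [u Hu].
  { intros i. destruct (classic (In i l)) as [h|h]; [|exists (0, 0); tauto].
    destruct (hr i h) as [v Hv]. exists v. auto. }
  destruct (eventually_list l (fun i z => snd (u i) <= z /\ fst (u i) < z)) as [K HK].
  { intros i _. exists (snd (u i) + S (fst (u i))). lia. }
  destruct (hD K) as [z [hz [hDz hres]]].
  (* Adding [fst (u i)] spoils the reservoir condition at [z], which [D] alone satisfies, so the
     clash is between [fst (u i)] and an element of [D]. *)
  destruct (choice (fun i a => In i l -> In a D /\ f [a; z] = f [fst (u i); z])) as [a Ha].
  { intros i. destruct (classic (In i l)) as [h|h]; [|exists 0; tauto].
    destruct (Hu i h) as [h1 [h2 h3]]. destruct (HK z hz i h) as [h4 h5].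
    apply NNPP. intros hn. apply (h3 z h4). split.
    - intros x [<-|hx]; auto.
    - intros p [<-|hp] q [<-|hq] hpq e; try tauto.
      + apply hn. exists q. auto.
      + apply hn. exists p. auto.
      + now apply (hres p hp q hq hpq). }
  rewrite <- (length_map a l). apply NoDup_incl_length.
  - apply NoDup_map_NoDup_ForallPairs; auto. intros i j hi hj e.
    destruct (Hu i hi) as [[[h1 _] _] [h2 _]]. destruct (Hu j hj) as [[[k1 _] _] [k2 _]].
    destruct (Ha i hi) as [h3 h4]. destruct (Ha j hj) as [k3 k4].
    assert (fst (u i) = fst (u j)); [|congruence].
    apply (three_same_color (a i) (fst (u i)) (fst (u j)) z).
    + now apply hDz.
    + now apply HK.
    + now apply HK.
    + specialize (h1 _ h3). lia.
    + rewrite e. specialize (k1 _ k3). lia.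
    + auto.
    + now rewrite e.
  - intros y hy. apply in_map_iff in hy as [i [<- hi]]. now apply Ha.
Qed.

(** [jump Q] serves only to describe the bad choices. Their avoidance is built into [g], so the
    construction itself consults just [X] and [Q]. *)
Lemma pairs_rainbow X (g : nat -> nat) :
  computable X g ->
  (forall c x, (forall l, NoDup l -> (forall y, In y l -> halts (jump Q) c (pair x y)) -> length l <= pair c x) ->
     ~ halts (jump Q) c (pair x (g (pair c x)))) ->
  exists R, turing_le R (join X Q) /\ infinite R /\ rainbow 2 f R.
Proof.
  intros Hg Havoid. set (A := join X Q).
  destruct (semi_code _ _ semi_ruined) as [p Hp].
  assert (Hc : forall D i, ruined (D, i) <-> halts (jump Q) (code p) (pair (enc D) i)).
  { intros D i. rewrite Hp. split.
    - intros h. now exists p.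
    - intros [q [hq h]]. apply code_inj in hq. now subst. }
  (* The value of [g] is read as a position among the candidates, so that any number names a legal
     choice. The code of [D] in the argument makes the bound on bad choices at least [length D]. *)
  set (choose := fun D : list nat => g (pair (code p) (enc D))).
  assert (Hchoose : forall D, infinite (reservoir D) -> ~ ruined (D, choose D)).
  { intros D hD. rewrite Hc. apply Havoid. intros l hl h.
    etransitivity; [apply (ruined_length D l hD hl)|].
    - intros i hi. now apply Hc, h.
    - etransitivity; [apply length_le_enc|]. apply pair_le_r. }
  pose proof (computable_le X A g (join_le_l X Q) Hg) as HgA.
  pose proof (join_le_r X Q : turing_le Q A) as HQA.
  (* Taking [z] from [D'] bounds the quantifier and makes the step decidable. *)
  set (step := fun D D' : list nat => exists z, In z D' /\
    (D' = z :: D /\ candidate D z /\ cnt z (candidate D) = choose D)).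
  destruct (comp_iterate A step (fun D => infinite (reservoir D)) []) as [D [HDA [D0 HD]]].
  - apply (decid_bex_list A (fun (t : list nat * list nat) z => snd t = z :: fst t /\
      candidate (fst t) z /\ cnt z (candidate (fst t)) = choose (fst t)) snd); [|cpt].
    apply decid_and; [dcd|]. apply decid_and; [apply decid_candidate; auto; cpt|].
    assert (computable A (fun t : (list nat * list nat) * nat => cnt (snd t) (candidate (fst (fst t))))).
    { apply (comp_cnt A (fun t : (list nat * list nat) * nat => snd t) (fun t => candidate (fst (fst t)))); [cpt|].
      apply decid_candidate; auto; cpt. }
    unfold choose. dcd.
  - intros N. exists N. split; auto. split; [intros x []|intros a []].
  - intros D hD. destruct (cnt_nth (candidate D) (choose D) (infinite_candidate D hD)) as [z [h1 h2]].
    exists (z :: D), z. split; [now left|]. auto.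
  - intros D D' hD [z [_ [-> [h1 h2]]]] N. apply NNPP. intros hn. apply (Hchoose D hD).
    exists (z, N). split; [exact h1|]. split; [exact h2|]. intros z' hz' hr. apply hn. eauto.
  (* [D (S n)] is never empty, so the default 0 does not arise. *)
  - set (y := fun n => match D (S n) with [] => 0 | z :: _ => z end).
    assert (Hy : computable A y).
    { unfold y. apply (comp_match_list A (fun _ => 0) (fun _ z _ => z) (fun n => D (S n))); cpt. }
    assert (HyD : forall n, D (S n) = y n :: D n /\ candidate (D n) (y n)).
    { intros n. destruct (HD n) as [_ [z [_ [e [h _]]]]]. unfold y. now rewrite e. }
    assert (HIn : forall i n, i < n -> In (y i) (D n)).
    { intros i n. induction 1 as [|n _ IH]; rewrite (proj1 (HyD _)); [now left|now right]. }
    assert (Hinc : forall n, y n < y (S n)).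
    { intros n. destruct (HyD (S n)) as [_ [[h _] _]]. apply h, HIn. lia. }
    exists (fun x => exists i, y i = x). split; [|split].
    + apply turing_le_decid. now apply decid_range.
    + intros N. exists (y N). split; [now apply increasing_ge|eauto].
    + assert (Hlt : forall i j, y i < y j -> i < j).
      { intros i j h. apply Nat.nle_gt. intros h'. apply (increasing_le y Hinc) in h'. lia. }
      assert (Hcross : forall i j i' j', i < j -> i' < j' -> j < j' -> f [y i; y j] <> f [y i'; y j']).
      { intros i j i' j' h1 h2 h3 e. destruct (HyD j') as [_ [_ h]].
        apply (h (y i') (HIn i' j' h2) (y i) (HIn i j' ltac:(lia)) (y j) (HIn j j' h3)); auto.
        now apply increasing_lt. }
      intros s t hs ht hsR htR e.
      destruct (is_mset_2 s hs) as [a [b [-> hab]]]. destruct (is_mset_2 t ht) as [a' [b' [-> hab']]].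
      destruct (hsR a) as [i <-]; [now left|]. destruct (hsR b) as [j <-]; [now right; left|].
      destruct (htR a') as [i' <-]; [now left|]. destruct (htR b') as [j' <-]; [now right; left|].
      apply Hlt in hab, hab'. destruct (Nat.lt_trichotomy j j') as [h|[<-|h]].
      * exfalso. now apply (Hcross i j i' j').
      * destruct (Nat.eq_dec (y i) (y i')) as [->|hne]; auto. exfalso.
        destruct (HyD j) as [_ [[_ h] _]]. now apply (h (y i) (HIn i j hab) (y i') (HIn i' j hab')).
      * exfalso. now apply (Hcross i' j' i j).
Qed.
End Pairs.

(** * Iterating the reduction *)

(** A program for a coloring may diverge off the [m]-sets, whereas [computable] asks for
    totality. *)
Lemma total_coloring m f : computable_coloring m f ->
  exists g, computable empty_set g /\ forall s, is_mset m s -> g s = f s.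
Proof.
  intros [p Hp].
  destruct (decid_is_mset empty_set (fun _ : list nat => m) (fun s => s)) as [q Hq]; try cpt.
  exists (fun s => if excluded_middle_informative (is_mset m s) then f s else 0). split.
  (* The recursion counter is the result of the test for [m]-sets: zero rounds return 0, one round
     runs [p]. *)
  - exists (PComp (PRec PZero (PComp p PFst)) (PPair (PPair PFst PSnd) q)). intros s.
    eapply ev_comp; [apply ev_pair; [apply eval_id|apply Hq]|].
    unfold chi. destruct excluded_middle_informative as [h|h].
    + eapply ev_recS; [apply ev_rec0, ev_zero|]. eapply ev_comp; [apply ev_fst|].
      rewrite unpair_pair. cbn [fst]. rewrite enc_list_nat. now apply Hp.
    + apply ev_rec0, ev_zero.
  - intros s h. now destruct excluded_middle_informative.
Qed.

(** The surplus exponent [k] is quantified after [Q], so the induction step can use the hypothesis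
    at [S k] and spend the extra exponent on the new oracle. *)
Lemma iterated_reduction n : exists Q,
  turing_le (zero_jump n) Q /\ turing_le (jump Q) (zero_jump (S n)) /\
  forall k f, computable empty_set f -> k_bounded (n + k + 2) 2 f ->
    exists h, computable Q h /\ k_bounded (k + 2) 2 h /\
      forall H, infinite H -> rainbow (k + 2) h H ->
        exists R, turing_le R (join H Q) /\ infinite R /\ rainbow (n + k + 2) f R.
Proof.
  induction n as [|n [Q [HQ1 [HQ2 HQ]]]].
  - exists empty_set. split; [apply turing_le_refl|]. split; [apply turing_le_refl|].
    intros k f Hf Hb. exists f. split; [auto|]. split; [auto|].
    intros H Hi Hr. exists H. split; [apply join_le_l|auto].
  - destruct (low_pa_exists (zero_jump (S n))) as [P [HP1 [HP2 HP3]]].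
    exists P. split; [exact HP1|]. split; [exact HP2|]. intros k f Hf Hb.
    assert (HQP : turing_le Q P).
    { eapply turing_le_trans; [apply le_jump|]. eapply turing_le_trans; eauto. }
    assert (HPA : pa_over (jump Q) P).
    { intros S0 S1 h0 h1. apply HP3; eapply semi_oracle_le; eauto. }
    replace (S n + k + 2) with (n + S k + 2) in * by lia.
    destruct (HQ (S k) f Hf Hb) as [h [Hh [Hhb HhR]]].
    destruct (exponent_reduction Q P (k + 2) h HQP HPA Hh Hhb) as [h' [Hh' [Hb' HR']]].
    exists h'. split; [auto|]. split; [auto|]. intros H Hi Hr.
    destruct (HR' H Hi Hr) as [H' [Hle [Hi' Hr']]]. destruct (HhR H' Hi' Hr') as [R [HR HR2]].
    exists R. split; [|exact HR2]. eapply turing_le_trans; [exact HR|].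
    apply join_lub; [exact Hle|]. eapply turing_le_trans; [exact HQP|apply join_le_r].
Qed.

Theorem theorem6 : forall n : nat,
  exists X : nset,
    turing_le (jump (jump (join X (zero_jump n)))) (zero_jump (n + 2)) /\
    forall f : coloring,
      computable_coloring (n + 2) f -> k_bounded (n + 2) 2 f ->
      exists R : nset, turing_le R X /\ infinite R /\ rainbow (n + 2) f R.
Proof.
  intros n. destruct (iterated_reduction n) as [Q [HQ1 [HQ2 HQ]]].
  destruct (low_random_exists Q) as [X [HX1 [HX2 [g [Hg Havoid]]]]].
  (* [Q] computes [zero_jump n], so joining the latter to this set does not raise its degree. *)
  exists (join X Q). split.
  - replace (n + 2) with (S (S n)) by lia.
    apply turing_le_trans with (jump (jump (join X Q))).
    + apply jump_mono, jump_mono, join_lub; [apply turing_le_refl|].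
      eapply turing_le_trans; [exact HQ1|apply join_le_r].
    + eapply turing_le_trans; [apply jump_mono, HX2|].
      eapply turing_le_trans; [exact HX1|]. now apply jump_mono.
  - intros f Hf Hb. destruct (total_coloring _ _ Hf) as [f' [Hf' E]].
    destruct (HQ 0 f' Hf') as [h [Hh [Hhb HhR]]].
    { rewrite Nat.add_0_r. intros y l Hnd Hl. apply (Hb y l Hnd). intros s hs.
      destruct (Hl s hs) as [h1 h2]. split; auto. now rewrite <- E. }
    destruct (pairs_rainbow Q h Hh Hhb X g Hg) as [H [HH [Hi Hr]]].
    { intros c x hc. now apply Havoid. }
    destruct (HhR H Hi Hr) as [R [HR [HRi HRr]]]. rewrite Nat.add_0_r in HRr.
    exists R. split; [|split; [exact HRi|]].
    + eapply turing_le_trans; [exact HR|]. apply join_lub; [exact HH|apply join_le_r].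
    + intros s t hs ht hsR htR e. apply HRr; auto. now rewrite !E.
Qed.
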